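(* Let $n\ge 2$ and $1\le k\le n$. The expected values of the squared chord length $\mathrm{Chord}(k)$ on the arm and polygon spaces with respect to the symmetric measure are $$E(\mathrm{Chord}(k),\mathrm{Arm}_3(n))=\frac{6k}{n(n+\frac12)},\qquad E(\mathrm{Chord}(k),\mathrm{Pol}_3(n))=\left(\frac{n-k}{n-1}\right)\frac{6k}{n(n+1)},$$ $$E(\mathrm{Chord}(k),\mathrm{Arm}_2(n))=\frac{8k}{n(n+1)},\qquad E(\mathrm{Chord}(k),\mathrm{Pol}_2(n))=\left(\frac{n-k}{n-1}\right)\frac{8k}{n(n+2)}.$$
   Context: Polygons. For $d\in\{2,3\}$, $\mathrm{Arm}_d(n)$ is the space of lists $(e_1,\dots,e_n)$ of edge vectors in $\mathbb{R}^d$ with $\sum|e_i|=2$, and $\mathrm{Pol}_d(n)\subset\mathrm{Arm}_d(n)$ is the subspace of closed polygons, $\sum e_i=0$. For such a polygon, $\mathrm{Chord}(k)=\left|\sum_{j=1}^k e_j\right|^2$. Hopf map. Let $\mathbb{H}$ be the quaternions with units $\mathbf i,\mathbf j,\mathbf k$. Identify $\mathbb{R}^3$ with the imaginary quaternions and $\mathbb{R}^2$ with the plane $\mathbf i\mathbb{R}\oplus\mathbf k\mathbb{R}$. Let $\mathrm{Hopf}(q)=\bar q\,\mathbf i\,q$, extended coordinatewise to $\mathbb{H}^n$, so that $q=(q_1,\dots,q_n)$ maps to the edge list $e_m=\bar q_m\mathbf i q_m$, with $|e_m|=|q_m|^2$. Identify $\mathbb{C}^n\times\mathbb{C}^n$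 with $\mathbb{H}^n$ by $(a,b)\mapsto a+b\,\mathbf j$, where $\mathbb{C}=\mathbb{R}\oplus\mathbf i\mathbb{R}$. Symmetric measure. $\mathrm{Hopf}$ maps the following model spaces onto the polygon spaces: the sphere $S^{4n-1}\subset\mathbb{H}^n$ of radius $\sqrt2$ onto $\mathrm{Arm}_3(n)$; the disjoint union $S^{2n-1}\sqcup S^{2n-1}$ of the spheres of radius $\sqrt2$ in $(\mathbb{R}\oplus\mathbf j\mathbb{R})^n$ and $(\mathbf i\mathbb{R}\oplus\mathbf k\mathbb{R})^n$ onto $\mathrm{Arm}_2(n)$; the Stiefel manifold $V_2(\mathbb{C}^n)$ of Hermitian-orthonormal pairs $(a,b)$ in $\mathbb{C}^n$ onto $\mathrm{Pol}_3(n)$; and $V_2(\mathbb{R}^n)\sqcup\mathbf i V_2(\mathbb{R}^n)$, where $V_2(\mathbb{R}^n)$ is the set of orthonormal pairs in $\mathbb{R}^n$, onto $\mathrm{Pol}_2(n)$. The symmetric measure on each polygon space is the pushforward under $\mathrm{Hopf}$ of the Riemannian volume measure (as a submanifold of $\mathbb{H}^n$) of its model space, normalized to total mass $1$. $E(f,X)$ denotes the expectation of $f$ on $X$ with respect to the symmetric measure. *)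

(* Defs.v *)
From HB Require Import structures.
From mathcomp Require Import all_boot all_order all_algebra.
From mathcomp Require Import complex.
From mathcomp Require Import all_classical all_reals all_analysis.
Import Order.TTheory GRing.Theory Num.Theory.
Import numFieldNormedType.Exports.

Local Open Scope classical_set_scope.
Local Open Scope ring_scope.

(* Conventions: a point of H^n is an 'M[R]_(n, 4) whose m-th row lists the
   coordinates of q_m in the basis 1, i, j, k; a list of n edge vectors in R^d
   is an 'M[R]_(n, d). The library norm on matrices is the sup norm, so that
   Euclidean lengths are written out below. *)

Section Polygons.
Context {R : realType}.

Definition eucl_norm {d} (v : 'rV[R]_d) : R :=
  Num.sqrt (\sum_(c < d) v 0 c ^+ 2).

Definition arm d n : set 'M[R]_(n, d) :=
  [set e | \sum_(m < n) eucl_norm (row m e) = 2].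

Definition pol d n : set 'M[R]_(n, d) :=
  arm d n `&` [set e | \sum_(m < n) row m e = 0].

Definition chord {d n} (k : nat) (e : 'M[R]_(n, d)) : R :=
  eucl_norm (\sum_(m < n | (m < k)%N) row m e) ^+ 2.

End Polygons.

Record quaternion (R : realType) := Quat { q1 : R ; qi : R ; qj : R ; qk : R }.
Arguments Quat {R}.
Arguments q1 {R}.
Arguments qi {R}.
Arguments qj {R}.
Arguments qk {R}.

Section Quaternions.
Context {R : realType}.
Local Notation quaternion := (quaternion R).

Definition qadd (p q : quaternion) : quaternion :=
  Quat (q1 p + q1 q) (qi p + qi q) (qj p + qj q) (qk p + qk q).

Definition qmul (p q : quaternion) : quaternion :=
  Quat (q1 p * q1 q - qi p * qi q - qj p * qj q - qk p * qk q)
       (q1 p * qi q + qi p * q1 q + qj p * qk q - qk p * qj q)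
       (q1 p * qj q - qi p * qk q + qj p * q1 q + qk p * qi q)
       (q1 p * qk q + qi p * qj q - qj p * qi q + qk p * q1 q).

Definition qconj (q : quaternion) : quaternion :=
  Quat (q1 q) (- qi q) (- qj q) (- qk q).

Definition unit_i : quaternion := Quat 0 1 0 0.
Definition unit_j : quaternion := Quat 0 0 1 0.

Definition quat_of_complex (z : R[i]) : quaternion :=
  Quat (complex.Re z) (complex.Im z) 0 0.

Definition hopf (q : quaternion) : quaternion :=
  qmul (qmul (qconj q) unit_i) q.

Definition quat_of_row (v : 'rV[R]_4) : quaternion :=
  Quat (v 0 0) (v 0 1) (v 0 2) (v 0 3).

Definition row_of_quat (q : quaternion) : 'rV[R]_4 :=
  \row_(c < 4) [:: q1 q; qi q; qj q; qk q]`_c.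

(* R^3 is the space of imaginary quaternions, R^2 the plane iR + kR. *)
Definition im3 (q : quaternion) : 'rV[R]_3 := \row_(c < 3) [:: qi q; qj q; qk q]`_c.
Definition im2 (q : quaternion) : 'rV[R]_2 := \row_(c < 2) [:: qi q; qk q]`_c.

Definition hopf3 {n} (q : 'M[R]_(n, 4)) : 'M[R]_(n, 3) :=
  \matrix_(m < n) im3 (hopf (quat_of_row (row m q))).
Definition hopf2 {n} (q : 'M[R]_(n, 4)) : 'M[R]_(n, 2) :=
  \matrix_(m < n) im2 (hopf (quat_of_row (row m q))).

Definition quat_of_pair {n} (p : 'cV[R[i]]_n * 'cV[R[i]]_n) : 'M[R]_(n, 4) :=
  \matrix_(m < n) row_of_quat
    (qadd (quat_of_complex (p.1 m 0)) (qmul (quat_of_complex (p.2 m 0)) unit_j)).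

End Quaternions.

Section ModelSpaces.
Context {R : realType}.

Definition sphere n : set 'M[R]_(n, 4) :=
  [set q | Num.sqrt (\sum_(m < n) \sum_(c < 4) q m c ^+ 2) = Num.sqrt 2].

Definition model_arm3 n : set 'M[R]_(n, 4) := sphere n.

Definition model_arm2 n : set 'M[R]_(n, 4) :=
  (sphere n `&` [set q | forall m : 'I_n,
     qi (quat_of_row (row m q)) = 0 /\ qk (quat_of_row (row m q)) = 0]) `|`
  (sphere n `&` [set q | forall m : 'I_n,
     q1 (quat_of_row (row m q)) = 0 /\ qj (quat_of_row (row m q)) = 0]).

Definition hermitian_prod {n} (a b : 'cV[R[i]]_n) : R[i] :=
  \sum_(m < n) a m 0 * conjc (b m 0).

Definition stiefelC n : set ('cV[R[i]]_n * 'cV[R[i]]_n) :=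
  [set p | [/\ hermitian_prod p.1 p.1 = 1, hermitian_prod p.2 p.2 = 1 &
               hermitian_prod p.1 p.2 = 0]].

Definition stiefelR n : set ('cV[R]_n * 'cV[R]_n) :=
  [set p : 'cV[R]_n * 'cV[R]_n | [/\
      \sum_(m < n) p.1 m 0 ^+ 2 = 1,
      \sum_(m < n) p.2 m 0 ^+ 2 = 1 &
      \sum_(m < n) p.1 m 0 * p.2 m 0 = 0]].

Definition model_pol3 n : set 'M[R]_(n, 4) := quat_of_pair @` stiefelC n.

Definition complexify {n} (v : 'cV[R]_n) : 'cV[R[i]]_n := map_mx (real_complex R) v.

Definition model_pol2 n : set 'M[R]_(n, 4) :=
  [set quat_of_pair (complexify p.1, complexify p.2) | p in stiefelR n] `|`
  [set quat_of_pair ('i%C *: complexify p.1, 'i%C *: complexify p.2) | p in stiefelR n].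

End ModelSpaces.

Notation borel V := (g_sigma_algebraType (@open V)).

Section RiemannianVolume.
Context {R : realType}.

(* Iterated product measure; row_mx (const_mx x) u is the vector (x, u_1, ..., u_m). *)
Fixpoint lebesgue_rV (m : nat) : set (borel 'rV[R]_m) -> \bar R :=
  match m return set (borel 'rV[R]_m) -> \bar R with
  | 0 => fun A => dirac (0 : borel 'rV[R]_0) A
  | m'.+1 => fun A => (\int[@lebesgue_measure R]_x
      lebesgue_rV m' [set u : borel 'rV[R]_m' | A (row_mx (const_mx x : 'rV[R]_1) u)])%E
  end.

Context {n d : nat}.
Local Notation V := 'M[R]_(n, d).

Definition partial {m} (phi : 'rV[R]_m -> V) (i : 'I_m) (u : 'rV[R]_m) : V :=
  'D_(delta_mx 0 i) phi u.

(* Matrix of the metric induced on the image of phi by the Euclidean inner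
   product of V. *)
Definition gram {m} (phi : 'rV[R]_m -> V) (u : 'rV[R]_m) : 'M[R]_m :=
  \matrix_(i, j) \sum_(s < n) \sum_(c < d) partial phi i u s c * partial phi j u s c.

(* Local C^1 parametrizations of M with domain U: injective immersions that are
   homeomorphisms onto a relatively open subset of M. *)
Definition local_param {m} (M : set V) (U : set 'rV[R]_m) (phi : 'rV[R]_m -> V) : Prop :=
  [/\ open U,
      forall (i : 'I_m) u, U u ->
        derivable phi u (delta_mx 0 i) /\ {for u, continuous (partial phi i)},
      forall u, U u -> gram phi u \in unitmx,
      {in U &, injective phi} &
      forall W, open W -> W `<=` U ->
        exists2 O : set V, open O & phi @` W = M `&` O].

(* mu is the Riemannian volume measure of the m-dimensional submanifold M of V,
   as a Borel measure on V carried by M. *)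
Definition riemannian_volume m (M : set V) (mu : {measure set (borel V) -> \bar R}) : Prop :=
  mu (~` M) = 0%E /\
  forall U (phi : 'rV[R]_m -> V), local_param M U phi ->
  forall A : set (borel V), measurable A -> A `<=` phi @` U ->
    mu A = (\int[lebesgue_rV m]_(u in U `&` phi @^-1` A) (Num.sqrt (\det (gram phi u)))%:E)%E.

End RiemannianVolume.

Section SymmetricMeasure.
Context {R : realType} {n d : nat}.

(* P is the image under h of the volume measure of the m-dimensional submanifold
   M, normalized; P having mass 1 forces the total volume to lie in ]0, +oo[. *)
Definition normalized_pushforward m (M : set 'M[R]_(n, 4))
    (h : 'M[R]_(n, 4) -> 'M[R]_(n, d)) (P : probability (borel 'M[R]_(n, d)) R) : Prop :=
  exists2 vol : {measure set (borel 'M[R]_(n, 4)) -> \bar R},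
    riemannian_volume m M vol &
    forall A, measurable A ->
      P A = ((fine (vol M))^-1%:E * pushforward vol (h : borel _ -> borel _) A)%E.

End SymmetricMeasure.

Section SymmetricMeasures.
Context {R : realType}.

(* The numbers 4n - 1, 2n - 1, 4n - 4 and 2n - 3 are the dimensions of the model
   spaces. *)
Definition symmetric_arm3 n := @normalized_pushforward R n 3 (4 * n - 1)%N (model_arm3 n) hopf3.
Definition symmetric_arm2 n := @normalized_pushforward R n 2 (2 * n - 1)%N (model_arm2 n) hopf2.
Definition symmetric_pol3 n := @normalized_pushforward R n 3 (4 * n - 4)%N (model_pol3 n) hopf3.
Definition symmetric_pol2 n := @normalized_pushforward R n 2 (2 * n - 3)%N (model_pol2 n) hopf2.

End SymmetricMeasures.

(* Main.v *)
(* The volume of each model space is determined by its charts, hence invariant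
   under every linear isometry preserving the space: such an isometry carries
   charts to charts with the same Gram matrix.  This needs finitely many charts
   covering the space.  They come from normalizing (for the Stiefel manifold,
   Gram-Schmidt orthonormalizing) an affine slice, and from moving these charts
   by a few isometries.

   Write q_m for the m-th row, X = E|q_m|^4 and e_m for the m-th edge.  The
   unitary change of rows (q_m, q_l) |-> (q_m + w q_l, q_l - conj(w) q_m)/sqrt 2,
   for the unit quaternions w allowed by the model, gives
   X = E(|q_m|^2 |q_l|^2) + 2 E<q_m, w q_l>^2.  Summing over enough w on the
   spheres, or using that the matrix (a_m conj(a_l) + b_m conj(b_l)) of a Stiefel
   point (a, b) is a projection, together with sum_l |q_l|^2 = 2, determines X.
   On arms E<e_m, e_l> = 0 for m <> l, since q_m |-> j q_m reverses e_m; on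
   polygons sum_l e_l = 0 and the symmetry in l give E<e_m, e_l> = - X/(n - 1).
   Expanding Chord(k) = sum_(m, l <= k) <e_m, e_l> concludes. *)

From HB Require Import structures.
Require Import Defs.
From mathcomp Require Import all_boot all_order all_algebra.
From mathcomp Require Import complex ring lra.
From mathcomp Require Import all_classical all_reals all_analysis measurable_realfun.
Import Order.TTheory GRing.Theory Num.Theory.
Import numFieldNormedType.Exports.
Local Open Scope classical_set_scope.
Local Open Scope ring_scope.
Set Implicit Arguments.
Unset Strict Implicit.
Unset Printing Implicit Defensive.

(** No volume or moment of a model space is computed. [riemannian_volume] characterizes a measure by
    its charts without constructing one, and the theorem is about every measure so characterized. An
    isometry pushes such a measure to another one, so invariance reduces to uniqueness, and
    uniqueness to explicit charts. Each chart comes with a differentiable left inverse on an open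
    set of the ambient space, from which immersivity and openness are read off.

    The planar models are spatial ones cut by [planar], a union of two linear subspaces. The units w
    allowed in the row change decide the constants: all unit quaternions on the full sphere, those
    of R + jR on its planar part, those of C on the complex Stiefel manifold, and only 1 and -1 on
    its planar part. With Y = E(|q_m|^2 |q_l|^2), the sphere cases give Y = 2X/3 and Y = X/2. On the
    Stiefel models too few units remain to tie Y to X, and the projection identity supplies the
    missing equation, in the form X(n + a) = (4 + 2a)/n with a = 1 or a = 2. *)

Section Borel.
Context {R : realType}.

Lemma continuous_borel_measurable {n d n' d' : nat}
    (f : 'M[R]_(n, d) -> 'M[R]_(n', d')) :
  continuous f -> measurable_fun setT (f : borel 'M[R]_(n, d) -> borel 'M[R]_(n', d')).
Proof.
move=> /continuousP cf.
apply: (measurability (rT := borel 'M[R]_(n', d')) (@open 'M[R]_(n', d'))) => // _ [B oB <-].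
by rewrite setTI; apply: sub_sigma_algebra; exact: cf.
Qed.

Lemma continuous_borel_measurable_real {n d : nat} (f : 'M[R]_(n, d) -> R) :
  continuous f -> measurable_fun setT (f : borel 'M[R]_(n, d) -> R).
Proof.
move=> /continuousP cf; apply: (measurability _ (measurable_realfun.RGenOpens.measurableE R)).
move=> _ [B [a [b ->]] <-].
by rewrite setTI; apply: sub_sigma_algebra; apply: cf; exact: interval_open.
Qed.

Lemma open_borel_measurable {n d : nat} (A : set 'M[R]_(n, d)) :
  open A -> measurable (A : set (borel 'M[R]_(n, d))).
Proof. by move=> oA; exact: sub_sigma_algebra. Qed.

End Borel.

Section LinearMaps.
Context {R : realType} {n d n' d' : nat}.

Lemma linear_sum_delta {f : 'M[R]_(n, d) -> 'M[R]_(n', d')} : linear f ->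
  forall x, f x = \sum_s \sum_c x s c *: f (delta_mx s c).
Proof.
move=> fL x; pose F := GRing.isLinear.Build R _ _ _ f fL.
pose g : {linear _ -> _} := HB.pack f F.
rewrite {1}[x]matrix_sum_delta -[f]/(g : _ -> _) linear_sum; apply: eq_bigr => s _.
by rewrite linear_sum; apply: eq_bigr => c _; rewrite linearZ.
Qed.

Lemma cvg_sumr {T : Type} {F : set_system T} {FF : Filter F} {W : normedModType R}
    {I : Type} (r : seq I) (f : I -> T -> W) (l : I -> W) :
  (forall i, f i @ F --> l i) ->
  (fun y => \sum_(i <- r) f i y) @ F --> \sum_(i <- r) l i.
Proof.
move=> fl; elim: r => [|i r IH].
  by rewrite big_nil; under eq_fun do rewrite big_nil; exact: cvg_cst.
by rewrite big_cons; under eq_fun do rewrite big_cons; exact: cvgD (fl i) IH.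
Qed.

Lemma linear_mx_continuous {f : 'M[R]_(n, d) -> 'M[R]_(n', d')} :
  linear f -> continuous f.
Proof.
move=> /linear_sum_delta fE x; rewrite (funext fE).
apply: (@cvg_sumr _ (nbhs x) _) => s; apply: (@cvg_sumr _ (nbhs x) _) => c.
by apply: cvgZr_tmp; exact: coord_continuous.
Qed.

Lemma derive_linear {m} {f : 'M[R]_(n, d) -> 'M[R]_(n', d')} {g : 'rV[R]_m -> 'M[R]_(n, d)}
    {u v : 'rV[R]_m} : linear f -> derivable g u v ->
  derivable (f \o g) u v /\ 'D_v (f \o g) u = f ('D_v g u).
Proof.
move=> fL dg.
have [fB fZ] : (forall x y, f (x - y) = f x - f y) /\ (forall a x, f (a *: x) = a *: f x).
  pose F := GRing.isLinear.Build R _ _ _ f fL.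
  pose h : {linear _ -> _} := HB.pack f F.
  by split=> *; [exact: (linearB h)|exact: (linearZZ h)].
have : f (h^-1 *: (g (h *: v + u) - g u)) @[h --> 0^'] --> f ('D_v g u).
  by apply: continuous_cvg dg; exact: linear_mx_continuous.
under eq_fun do rewrite fZ fB.
by move=> h; split; [exact: cvgP h|exact: cvg_lim h].
Qed.

End LinearMaps.

(** * Invariance of the volume under isometries *)

Section Symmetries.
Context {R : realType} {n d : nat}.
Local Notation V := 'M[R]_(n, d).
Implicit Types (M : set V) (T S : V -> V) (x y : V).

Definition mxdot x y : R := \sum_s \sum_c x s c * y s c.

(** The inverse S is carried along so that images under T are preimages under S. Both maps preserve
    M, which gives T(M) = M; that S is an isometry as well follows from the other fields. *)
Record symmetry M T S : Prop := Symmetry {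
  sym_linear : linear T;
  symK : cancel T S;
  symVK : cancel S T;
  sym_dot : forall x y, mxdot (T x) (T y) = mxdot x y;
  sym_sub : forall x, M x -> M (T x);
  symV_sub : forall x, M x -> M (S x) }.

Lemma symmetryV M T S : symmetry M T S -> symmetry M S T.
Proof.
case=> TL TS ST Td TM SM; split => //.
- move=> a x y; apply: (can_inj TS).
  by rewrite ST TL !ST.
- by move=> x y; rewrite -Td !ST.
Qed.

Lemma symmetry_comp M T S T' S' : symmetry M T S -> symmetry M T' S' ->
  symmetry M (T \o T') (S' \o S).
Proof.
case=> TL TS ST Td TM SM [TL' TS' ST' Td' TM' SM']; split => /=.
- by move=> a x y /=; rewrite TL' TL.
- exact: can_comp.
- exact: can_comp.
- by move=> x y; rewrite Td Td'.
- by move=> x /TM'/TM.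
- by move=> x /SM/SM'.
Qed.

Lemma symmetry_id M : symmetry M idfun idfun.
Proof. by split. Qed.

Lemma symmetry_iter M T S k : symmetry M T S -> symmetry M (iter k T) (iter k S).
Proof.
move=> TS; elim: k => [|k IH]; first exact: symmetry_id.
suff -> : iter k.+1 S = iter k S \o S by exact: symmetry_comp TS IH.
by apply/funext => x; rewrite iterSr.
Qed.

Lemma symmetry_setI M N T S : symmetry M T S -> symmetry N T S ->
  symmetry (M `&` N) T S.
Proof.
case=> TL TS ST Td TM SM [_ _ _ _ TN SN]; split => // x [Mx Nx].
  by split; [exact: TM|exact: TN].
by split; [exact: SM|exact: SN].
Qed.

Lemma symmetry_continuous {M T S} : symmetry M T S -> continuous T.
Proof. by case=> TL *; exact: linear_mx_continuous. Qed.

Lemma symmetry_image {M T S} (A : set V) : symmetry M T S -> T @` A = S @^-1` A.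
Proof.
case=> TL TS ST *; rewrite eqEsubset; split => [_ [x Ax <-]|x Ax] /=.
  by rewrite TS.
by exists (S x) => //; rewrite ST.
Qed.

Lemma symmetry_imageM {M T S} : symmetry M T S -> T @` M = M.
Proof.
move=> sT; rewrite (symmetry_image _ sT) eqEsubset.
case: sT => _ TS ST _ TM SM; split => x /= Mx; last exact: SM.
by rewrite -(ST x); exact: TM.
Qed.

Context {m : nat}.

(** A linear T commutes with partial derivatives, and being orthogonal it keeps their inner
    products. *)
Lemma gram_symmetry {M T S} (phi : 'rV[R]_m -> V) (u : 'rV[R]_m) :
  symmetry M T S -> (forall i, derivable phi u (delta_mx 0 i)) ->
  gram (T \o phi) u = gram phi u.
Proof.
case=> TL _ _ Td _ _ dphi; apply/matrixP => i j; rewrite !mxE.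
have pE k : partial (T \o phi) k u = T (partial phi k u).
  by rewrite /partial (derive_linear TL (dphi k)).2.
by rewrite !pE; exact: Td.
Qed.

Lemma local_param_symmetry {M T S} {U} {phi : 'rV[R]_m -> V} :
  symmetry M T S -> local_param M U phi -> local_param M U (T \o phi).
Proof.
move=> sT [oU dphi gphi iphi ophi].
have TL := sym_linear sT.
have cT := linear_mx_continuous TL.
split=> [|i u Uu|u Uu|u v uU vU|W oW WU].
- exact: oU.
- have [du cu] := dphi i u Uu; split; first exact: (derive_linear TL du).1.
  (* The two sides are known to agree only on U; since U is open, this is enough for continuity at
     u. *)
  have e : {near u, T \o partial phi i =1 partial (T \o phi) i}.
    apply: filterS (open_nbhs_nbhs (conj oU Uu)) => w Uw.
    by rewrite /= /partial (derive_linear TL (dphi i w Uw).1).2.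
  have pu : partial (T \o phi) i u = T (partial phi i u) := (derive_linear TL du).2.
  change (partial (T \o phi) i @ u --> partial (T \o phi) i u); rewrite pu.
  apply: (cvg_trans (near_eq_cvg e)).
  by apply: (continuous_comp cu); exact: linear_mx_continuous.
- by rewrite (gram_symmetry sT) ?gphi// => i; exact: (dphi i u Uu).1.
- by move/(can_inj (symK sT)); exact: iphi.
- have [B oB phiB] := ophi W oW WU; exists (S @^-1` B).
    by apply: open_comp oB => x _; exact: symmetry_continuous (symmetryV sT) x.
  rewrite -[LHS]image_comp phiB (symmetry_image _ sT) preimage_setI.
  by rewrite -(symmetry_image M sT) (symmetry_imageM sT).
Qed.

End Symmetries.

(* [eq_integral] is only available for measures; [lebesgue_rV] is a bare set function. *)
Lemma eq_integral_setfun {dT} {T : measurableType dT} {R : realType} (mu : set T -> \bar R)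
    (D : set T) (f g : T -> \bar R) :
  {in D, f =1 g} -> (\int[mu]_(x in D) f x = \int[mu]_(x in D) g x)%E.
Proof. by rewrite /integral => /eq_restrictP ->. Qed.

Section VolumeInvariance.
Context {R : realType} {n d m : nat}.
Local Notation V := 'M[R]_(n, d).
Implicit Types (M : set V) (mu nu : {measure set (borel V) -> \bar R}).

Definition charted M (B : set V) : Prop :=
  exists (U : set 'rV[R]_m) (phi : 'rV[R]_m -> V), local_param M U phi /\ phi @` U = M `&` B.

(** Being charted is asked only of those [B i] that serve a point of M: the index types used later
    contain pairs of equal rows, for which no chart is built. Openness of all [B i] makes them
    measurable. *)
Definition finite_atlas M : Prop :=
  exists (I : finType) (B : I -> set V),
    (forall i, open (B i)) /\ forall x, M x -> exists i, B i x /\ charted M (B i).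

(** Cutting A along the [B i] one after the other leaves pieces that each lie in the image of one
    chart, where both measures are given by the same integral. *)
Lemma riemannian_volume_unique M mu nu :
  finite_atlas M -> measurable (M : set (borel V)) ->
  riemannian_volume m M mu -> riemannian_volume m M nu ->
  forall A : set (borel V), measurable A -> mu A = nu A.
Proof.
move=> [I [B [oB cover]]] mM [muM muE] [nuM nuE].
have mB i : measurable (B i : set (borel V)) := open_borel_measurable (oB i).
have key (s : seq I) (A : set (borel V)) : measurable A -> A `<=` M ->
    (forall x, A x -> exists i, [/\ i \in s, B i x & charted M (B i)]) -> mu A = nu A.
  elim: s A => [|i s IH] A mA AM Acover.
    suff -> : A = set0 by rewrite !measure0.
    by rewrite -subset0 => x /Acover[i []].
  (* An index without chart is dropped from the list; no point of A relies on it. *)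
  have [[U [phi [phiP phiB]]]|NBi] := pselect (charted M (B i)); last first.
    apply: IH => // x /Acover[j [+ Bj cj]]; rewrite inE => /orP[/eqP ji|js].
      by rewrite ji in cj.
    by exists j.
  have eA (l : {measure set (borel V) -> \bar R}) :
      l A = (l (A `&` B i) + l (A `\` B i))%E.
    rewrite -measureU ?setDE -?setIUr ?setUv ?setIT//.
    - exact: measurableI.
    - by apply: measurableI => //; exact: measurableC.
    - by rewrite setIACA setICr setI0.
  rewrite (eA mu) (eA nu); congr (_ + _)%E; last first.
    apply: IH; first exact: measurableD.
      by move=> x [/AM].
    move=> x [Ax Bx]; have [j [+ Bj cj]] := Acover x Ax.
    by rewrite inE => /orP[/eqP jE|js]; [rewrite jE in Bj|exists j].
  have sub : A `&` B i `<=` phi @` U by rewrite phiB; exact: setSI.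
  have mAB : measurable (A `&` B i) by exact: measurableI.
  by rewrite (muE _ _ phiP _ mAB sub) (nuE _ _ phiP _ mAB sub).
move=> A mA.
have eA (l : {measure set (borel V) -> \bar R}) : l (~` M) = 0%E ->
    l A = l (A `&` M).
  move=> lM; have mC : measurable (~` M : set (borel V)) by exact: measurableC.
  rewrite -[in LHS](setIT A) -(setUv M) setIUr measureU.
  - rewrite [X in (_ + X)%E](_ : _ = 0%E) ?adde0//.
    apply/eqP; rewrite eq_le measure_ge0 andbT -lM le_measure ?inE//.
    exact: measurableI.
  - exact: measurableI.
  - exact: measurableI.
  - by rewrite setIACA setICr setI0.
(* Both measures vanish off M, so A may be replaced by its part in M, which the charts cover. *)
rewrite (eA mu)// (eA nu)//; apply: (key (enum I)).
- exact: measurableI.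
- by move=> x [].
- by move=> x [_ /cover[i [Bi ci]]]; exists i; rewrite mem_enum.
Qed.

(** The pushforward of [mu] under T is again a Riemannian volume of M, hence equals [mu] by
    uniqueness. *)
Lemma riemannian_volume_symmetry M T S mu : symmetry M T S -> finite_atlas M ->
  measurable (M : set (borel V)) -> riemannian_volume m M mu ->
  forall A : set (borel V), measurable A -> mu (T @^-1` A) = mu A.
Proof.
move=> sT atl mM muM A mA.
have mT : measurable_fun setT (T : borel V -> borel V).
  exact: continuous_borel_measurable (symmetry_continuous sT).
pose push : {measure set (borel V) -> \bar R} := pushforward mu (T : borel V -> borel V).
pose nu := push mT.
change (nu A = mu A); apply: (riemannian_volume_unique atl mM _ muM mA).
case: (muM) => mu0 muE; split.
  have -> : nu (~` M) = mu (~` (T @^-1` M)) by [].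
  by rewrite -(symmetry_image _ (symmetryV sT)) (symmetry_imageM (symmetryV sT)).
move=> U phi phiP B mB Bsub; rewrite /nu/push/= /pushforward/=.
have sS := symmetryV sT.
(* The preimage of B under T lies in the image of the chart [S \o phi], whose integration domain and
   density are those of [phi]. *)
rewrite (muE U (S \o phi) (local_param_symmetry sS phiP)).
- have -> : (S \o phi) @^-1` (T @^-1` B) = phi @^-1` B.
    by rewrite eqEsubset; split => x /=; rewrite (symVK sT).
  have e : {in U `&` phi @^-1` B, (fun u => (Num.sqrt (\det (gram (S \o phi) u)))%:E) =1
      (fun u => (Num.sqrt (\det (gram phi u)))%:E)}.
    move=> u; rewrite inE => -[Uu _].
    by rewrite (gram_symmetry sS)// => i; case: phiP => _ /(_ i u Uu)[].
  exact: (eq_integral_setfun (T := borel 'rV[R]_m) (@lebesgue_rV R m) e).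
- by have := mT measurableT _ mB; rewrite setTI.
- move=> x /Bsub[u Uu ux]; exists u => //=.
  by rewrite ux (symK sT).
Qed.

Lemma charted_symmetry M T S (B : set V) : symmetry M T S -> charted M B ->
  charted M (S @^-1` B).
Proof.
move=> sT [U [phi [phiP phiB]]]; exists U, (T \o phi); split.
  exact: local_param_symmetry sT phiP.
rewrite -[LHS]image_comp phiB (symmetry_image _ sT) preimage_setI.
by rewrite -(symmetry_image M sT) (symmetry_imageM sT).
Qed.

(** A chart around a moved point is moved back by the inverse isometry. With bounded exponents only
    finitely many translates arise. *)
Lemma finite_atlas_translate M G G' H H' (I : finType) (B : I -> set V) (p q : nat) :
  symmetry M G G' -> symmetry M H H' -> (forall i, open (B i)) ->
  (forall x, M x -> exists i (k : 'I_p) (l : 'I_q),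
    B i (iter l H (iter k G x)) /\ charted M (B i)) ->
  finite_atlas M.
Proof.
move=> sG sH oB cover.
have sT k l : symmetry M (iter l H \o iter k G) (iter k G' \o iter l H').
  exact: symmetry_comp (symmetry_iter l sH) (symmetry_iter k sG).
exists (I * ('I_p * 'I_q))%type, (fun i : I * ('I_p * 'I_q) => (iter i.2.2 H \o iter i.2.1 G) @^-1` B i.1); split.
  move=> i; apply: open_comp (oB i.1) => x _.
  exact: symmetry_continuous (sT i.2.1 i.2.2) x.
move=> x /cover[i [k [l [Bx ci]]]]; exists (i, (k, l)); split=> //=.
exact: charted_symmetry (symmetryV (sT k l)) ci.
Qed.

End VolumeInvariance.

(** * Charts *)

Section C1Functions.
Context {R : realType} {m : nat}.
Implicit Types f g : 'rV[R]_m -> R.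

(** Asked on the whole of R^m, the domain of every chart below. Total differentiability is included
    to have the chain rule available. *)
Definition C1 f : Prop :=
  (forall u, differentiable f u) /\ forall v, continuous ('D_v f).

Lemma C1_cst (a : R) : C1 (fun=> a).
Proof.
split=> [u|v]; first exact: differentiable_cst.
have -> : 'D_v (fun=> a : R) = cst 0 :> ('rV[R]_m -> R).
  by apply/funext => u; exact: derive_cst.
exact: cst_continuous.
Qed.

Lemma C1_coord (i : 'I_m) : C1 (fun u => u 0 i).
Proof.
split=> [u|v]; first exact: differentiable_coord.
have -> : 'D_v (fun u : 'rV[R]_m => u 0 i) = cst (v 0 i) :> ('rV[R]_m -> R).
  apply/funext => u; have := @derive_mx R _ 1 m id u v (@derivable_id _ _ u v).
  by rewrite derive_id => /matrixP/(_ 0 i); rewrite mxE.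
exact: cst_continuous.
Qed.

Lemma C1D f g : C1 f -> C1 g -> C1 (fun u => f u + g u).
Proof.
move=> [df cf] [dg cg]; split=> [u|v]; first exact: differentiableD.
have -> : 'D_v (fun u => f u + g u) = (fun u => 'D_v f u + 'D_v g u).
  by apply/funext => u; apply: deriveD; exact: diff_derivable.
by move=> u; exact: (cvgD (cf v u) (cg v u)).
Qed.

Lemma C1M f g : C1 f -> C1 g -> C1 (fun u => f u * g u).
Proof.
move=> [df cf] [dg cg]; split=> [u|v]; first exact: differentiableM.
have -> : 'D_v (fun u => f u * g u) = (fun u => f u * 'D_v g u + g u * 'D_v f u).
  by apply/funext => u; apply: deriveM; exact: diff_derivable.
move=> u.
exact: cvgD (cvgM (differentiable_continuous (df u)) (cg v u))
  (cvgM (differentiable_continuous (dg u)) (cf v u)).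
Qed.

Lemma C1_sum {I : Type} (r : seq I) (f : I -> 'rV[R]_m -> R) :
  (forall i, C1 (f i)) -> C1 (fun u => \sum_(i <- r) f i u).
Proof.
move=> Cf; elim: r => [|i r IH].
  by under eq_fun do rewrite big_nil; exact: C1_cst.
by under eq_fun do rewrite big_cons; exact: C1D.
Qed.

Lemma C1N f : C1 f -> C1 (fun u => - f u).
Proof.
move=> Cf; under eq_fun do rewrite -mulN1r; apply: C1M Cf; exact: C1_cst.
Qed.

Lemma C1_comp (h h' : R -> R) f : C1 f ->
  (forall u, is_derive (f u) 1 h (h' (f u))) ->
  (forall u, {for f u, continuous h'}) ->
  C1 (h \o f).
Proof.
move=> [df cf] dh ch'.
have Dh u : differentiable h (f u) by apply/derivable1_diffP; case: (dh u).
split=> [u|v]; first exact: differentiable_comp.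
have -> : 'D_v (h \o f) = (fun u => 'D_v f u * h' (f u)).
  apply/funext => u; rewrite deriveE; last exact: differentiable_comp.
  rewrite diff_comp//= diff1E// derive1E (@derive_val _ _ _ _ _ _ _ (dh u)).
  by rewrite -deriveE.
move=> u; apply: (cvgM (cf v u)).
exact: continuous_comp (differentiable_continuous (df u)) (ch' u).
Qed.

(** The only operation in the parametrizations that is not polynomial. *)
Lemma C1_invsqrt f : C1 f -> (forall u, 0 < f u) -> C1 (fun u => (Num.sqrt (f u))^-1).
Proof.
move=> Cf f0.
pose h' (x : R) := - (Num.sqrt x) ^- 2 *: (2 * Num.sqrt x)^-1.
apply: (C1_comp (h := fun x => (Num.sqrt x)^-1) (h' := h') Cf) => u.
  have s0 : Num.sqrt (f u) != 0 by rewrite sqrtr_eq0 -ltNge.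
  by apply: is_deriveV => //; exact: is_derive1_sqrt.
have s0 : Num.sqrt (f u) != 0 by rewrite sqrtr_eq0 -ltNge.
have cs := @sqrt_continuous R (f u).
have c1 : - (Num.sqrt x) ^- 2 @[x --> f u] --> - (Num.sqrt (f u)) ^- 2.
  apply: cvgN; apply: cvgV; first by rewrite expf_neq0.
  exact: (cvgM cs cs).
have c2 : (2 * Num.sqrt x)^-1 @[x --> f u] --> (2 * Num.sqrt (f u))^-1.
  apply: cvgV; first by rewrite mulf_neq0// pnatr_eq0.
  exact: cvgM (cvg_cst _) cs.
exact: cvgM c1 c2.
Qed.

End C1Functions.

Section Charts.
Context {R : realType} {n d m : nat}.
Local Notation V := 'M[R]_(n, d).

Lemma mxdot_sumr (x : V) (I : Type) (r : seq I) (a : I -> R) (p : I -> V) :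
  mxdot x (\sum_(i <- r) a i *: p i) = \sum_(i <- r) a i * mxdot x (p i).
Proof.
rewrite /mxdot; under [RHS]eq_bigr do rewrite mulr_sumr.
rewrite [RHS]exchange_big/=; apply: eq_bigr => s _.
under [RHS]eq_bigr do rewrite mulr_sumr.
rewrite [RHS]exchange_big/=; apply: eq_bigr => c _.
rewrite summxE mulr_sumr; apply: eq_bigr => i _.
by rewrite mxE mulrCA.
Qed.

Lemma mxdotC (x y : V) : mxdot x y = mxdot y x.
Proof. by rewrite /mxdot; apply: eq_bigr => s _; apply: eq_bigr => c _; rewrite mulrC. Qed.

Lemma mxdot_eq0 (x : V) : mxdot x x = 0 -> x = 0.
Proof.
move=> /eqP; rewrite psumr_eq0; last first.
  by move=> s _; apply: sumr_ge0 => c _; rewrite -expr2 sqr_ge0.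
move=> /allP x0; apply/matrixP => s c; rewrite mxE; apply/eqP.
have := x0 s (mem_index_enum _); rewrite psumr_eq0; last first.
  by move=> {}c _; rewrite -expr2 sqr_ge0.
by move=> /allP/(_ c (mem_index_enum _)); rewrite -expr2 sqrf_eq0.
Qed.

Lemma differentiable_mx {n' d' : nat} {W : normedModType R} (phi : W -> 'M[R]_(n', d')) (u : W) :
  (forall s c, differentiable (fun w => phi w s c) u) -> differentiable phi u.
Proof.
move=> dphi.
have -> : phi = \sum_s \sum_c (fun w => phi w s c *: delta_mx s c).
  apply/funext => w; rewrite fct_sumE {1}[phi w]matrix_sum_delta.
  by apply: eq_bigr => s _; rewrite fct_sumE.
apply: differentiable_sum => s; apply: differentiable_sum => c.
exact: differentiableZl.
Qed.

(** The functions [psi] recover the coordinates of a point. Differentiating [psi i (phi u) = u 0 i]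
    makes the differential of [phi] injective, and pulling W back along [psi] shows that its image
    is relatively open. *)
Lemma local_param_chart (M B : set V) (phi : 'rV[R]_m -> V) (psi : 'I_m -> V -> R) :
  (forall s c, C1 (fun u => phi u s c)) -> open B ->
  (forall i x, B x -> differentiable (psi i) x) ->
  (forall u, M (phi u) /\ B (phi u)) ->
  (forall u i, psi i (phi u) = u 0 i) ->
  (forall x, M x -> B x -> phi (\row_i psi i x) = x) ->
  local_param M setT phi /\ phi @` setT = M `&` B.
Proof.
move=> phiC oB psiD phiMB psiK phiK.
have phiD u : differentiable phi u by apply: differentiable_mx => s c; case: (phiC s c).
have psiphi u : \row_i psi i (phi u) = u by apply/rowP => i; rewrite mxE.
split; last first.
  rewrite eqEsubset; split => [_ [u _ <-]|x [Mx Bx]]; first exact: phiMB.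
  by exists (\row_i psi i x) => //; exact: phiK.
have partialE i u : partial phi i u =
    \matrix_(s, c) 'D_(delta_mx 0 i) (fun w => phi w s c) u.
  by rewrite /partial derive_mx//; exact: diff_derivable.
split.
- exact: openT.
- move=> i u _; split; first exact: diff_derivable.
  have -> : partial phi i =
      fun w => \sum_s \sum_c ('D_(delta_mx 0 i) (fun w => phi w s c) w) *: delta_mx s c.
    apply/funext => w; rewrite partialE [LHS]matrix_sum_delta.
    by apply: eq_bigr => s _; apply: eq_bigr => c _; rewrite mxE.
  apply: (@cvg_sumr _ _ (nbhs u) _) => s; apply: (@cvg_sumr _ _ (nbhs u) _) => c.
  by apply: cvgZr_tmp; case: (phiC s c) => _; exact.
- move=> u _.
  have inj (v : 'rV[R]_m) : 'D_v phi u = 0 -> v = 0.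
    move=> Dv0; apply/rowP => i; rewrite mxE.
    have e : (psi i \o phi) = (fun w : 'rV[R]_m => w 0 i).
      by apply/funext => w /=; rewrite psiK.
    have dpsi : differentiable (psi i) (phi u) by apply: psiD; case: (phiMB u).
    have := diff_comp (phiD u) dpsi.
    move=> /(congr1 (fun F => F v)) /=.
    rewrite -(deriveE v (phiD u)) Dv0 linear0 e -deriveE; last exact: differentiable_coord.
    have := @derive_mx R _ 1 m id u v (@derivable_id _ _ u v).
    by rewrite derive_id => /matrixP/(_ 0 i); rewrite mxE => <-.
  have DvE (v : 'rV[R]_m) : 'D_v phi u = \sum_i v 0 i *: partial phi i u.
    rewrite deriveE// {1}(row_sum_delta v) linear_sum; apply: eq_bigr => i _.
    by rewrite linearZ /partial deriveE.
  (* A row v killed by the Gram matrix G has |D_v phi|^2 = v G v^T = 0, so the differential of [phi]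
     kills v. *)
  apply/negPn/negP; rewrite -row_free_unit -kermx_eq0 => /rowV0Pn[v].
  move=> /sub_kermxP vG v0; move/negP: v0; apply; apply/eqP/inj.
  apply: mxdot_eq0; rewrite {2}DvE mxdot_sumr big1// => j _.
  rewrite mxdotC DvE mxdot_sumr.
  have /rowP/(_ j) := vG; rewrite !mxE => vGj.
  rewrite (_ : \sum_i _ = 0) ?mulr0// -[RHS]vGj; apply: eq_bigr => i _.
  by rewrite mxE -[X in _ = _ * X]/(mxdot _ _) mxdotC.
- by move=> u v _ _ uv; rewrite -(psiphi u) uv psiphi.
- move=> W oW _; exists (B `&` [set x | W (\row_i psi i x)]).
  rewrite openE => x [Bx Wx]; apply: filterI; first exact: open_nbhs_nbhs.
  have : differentiable (fun y => \row_i psi i y) x.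
    apply: differentiable_mx => i j.
    by under eq_fun do rewrite mxE; exact: psiD.
  move=> /differentiable_continuous; apply.
  exact: open_nbhs_nbhs.
rewrite eqEsubset; split => [_ [u Wu <-]|x [Mx [Bx Wx]]].
  by have [? ?] := phiMB u; split=> //; split => //=; rewrite psiphi.
by exists (\row_i psi i x) => //; exact: phiK.
Qed.

End Charts.

(** * The model spaces in coordinates *)

Section Coordinates.
Context {R : realType} {n : nat}.
Local Notation V := 'M[R]_(n, 4).
Implicit Types (x y : V) (s : 'I_n).

Lemma ord4P (P : 'I_4 -> Prop) : P 0 -> P 1 -> P 2 -> P 3 -> forall c, P c.
Proof.
move=> P0 P1 P2 P3 [[|[|[|[|c]]]] lt_c4] //.
- by have -> : Ordinal lt_c4 = 0 by exact: val_inj.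
- by have -> : Ordinal lt_c4 = 1 by exact: val_inj.
- by have -> : Ordinal lt_c4 = 2 by exact: val_inj.
- by have -> : Ordinal lt_c4 = 3 by exact: val_inj.
Qed.

Lemma sum_ord4 (F : 'I_4 -> R) : \sum_(c < 4) F c = F 0 + F 1 + F 2 + F 3.
Proof.
rewrite !big_ord_recr big_ord0 /= add0r.
by congr (F _ + F _ + F _ + F _); exact: val_inj.
Qed.

Definition mx4 (f0 f1 f2 f3 : 'I_n -> R) : V :=
  \matrix_(s, c) [:: f0 s; f1 s; f2 s; f3 s]`_c.

Lemma mx4E f0 f1 f2 f3 :
  ((forall s, mx4 f0 f1 f2 f3 s 0 = f0 s) * (forall s, mx4 f0 f1 f2 f3 s 1 = f1 s)) *
  ((forall s, mx4 f0 f1 f2 f3 s 2 = f2 s) * (forall s, mx4 f0 f1 f2 f3 s 3 = f3 s)).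
Proof. by do !split; move=> s; rewrite mxE. Qed.

Lemma mx4_ext x y : (forall s, [/\ x s 0 = y s 0, x s 1 = y s 1, x s 2 = y s 2 & x s 3 = y s 3]) ->
  x = y.
Proof.
move=> xy; apply/matrixP => s; have [? ? ? ?] := xy s; exact: ord4P.
Qed.

(* For x = a + b j with a, b in C^n: |a|^2, |b|^2 and the real and imaginary
   parts of sum_s b_s conj(a_s). *)
Definition sqnA x : R := \sum_s (x s 0 ^+ 2 + x s 1 ^+ 2).
Definition sqnB x : R := \sum_s (x s 2 ^+ 2 + x s 3 ^+ 2).
Definition hermRe x : R := \sum_s (x s 2 * x s 0 + x s 3 * x s 1).
Definition hermIm x : R := \sum_s (x s 3 * x s 0 - x s 2 * x s 1).

(** The rows all lie in R + jR, or all in iR + kR. The choice is made once for all rows, which gives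
    the two components of the planar models. *)
Definition planar : set V :=
  [set x | forall s, x s 1 = 0 /\ x s 3 = 0] `|` [set x | forall s, x s 0 = 0 /\ x s 2 = 0].

Lemma sphereE : sphere n = [set x : V | sqnA x + sqnB x = 2].
Proof.
apply/seteqP.
have e x : \sum_(m < n) \sum_(c < 4) x m c ^+ 2 = sqnA x + sqnB x.
  rewrite /sqnA /sqnB -big_split/=; apply: eq_bigr => s _.
  by rewrite sum_ord4 !addrA.
have x0 x : 0 <= sqnA x + sqnB x.
  by rewrite -e; apply: sumr_ge0 => s _; apply: sumr_ge0 => c _; exact: sqr_ge0.
split=> x; rewrite /sphere/= e; last by move=> ->.
by move/eqP; rewrite eqr_sqrt// ?ler0n// => /eqP.
Qed.

Lemma model_arm2E : model_arm2 n = sphere n `&` planar.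
Proof.
rewrite /model_arm2 /planar setIUr; congr (_ `&` _ `|` _ `&` _);
  by apply/seteqP; split=> x /= h s; have := h s; rewrite !mxE.
Qed.

Lemma complex_sumE (I : Type) (r : seq I) (f g : I -> R) :
  \sum_(i <- r) (f i +i* g i)%C = ((\sum_(i <- r) f i) +i* (\sum_(i <- r) g i))%C.
Proof.
elim: r => [|i r IH]; first by rewrite !big_nil.
by rewrite !big_cons IH.
Qed.

Lemma quat_of_pairE (p : 'cV[R[i]]_n * 'cV[R[i]]_n) :
  quat_of_pair p = mx4 (fun s => complex.Re (p.1 s 0)) (fun s => complex.Im (p.1 s 0))
                       (fun s => complex.Re (p.2 s 0)) (fun s => complex.Im (p.2 s 0)).
Proof.
apply: mx4_ext => s; rewrite !mx4E !mxE /=.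
split; ring.
Qed.

Lemma hermitian_prodE (a b : 'cV[R[i]]_n) : hermitian_prod a b =
  ((\sum_s (complex.Re (a s 0) * complex.Re (b s 0) + complex.Im (a s 0) * complex.Im (b s 0))) +i*
   (\sum_s (complex.Im (a s 0) * complex.Re (b s 0) - complex.Re (a s 0) * complex.Im (b s 0))))%C.
Proof.
rewrite -complex_sumE; apply: eq_bigr => s _.
case: (a s 0) => a0 a1; case: (b s 0) => b0 b1 /=.
by congr (_ +i* _)%C; ring.
Qed.

Lemma stiefelCE (p : 'cV[R[i]]_n * 'cV[R[i]]_n) (x := quat_of_pair p) :
  stiefelC n p <-> [/\ sqnA x = 1, sqnB x = 1, hermRe x = 0 & hermIm x = 0].
Proof.
have eA : hermitian_prod p.1 p.1 = (sqnA x +i* 0)%C.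
  rewrite hermitian_prodE /x quat_of_pairE; congr (_ +i* _)%C; [apply: eq_bigr|apply: big1];
  by move=> s _; rewrite ?mx4E; ring.
have eB : hermitian_prod p.2 p.2 = (sqnB x +i* 0)%C.
  rewrite hermitian_prodE /x quat_of_pairE; congr (_ +i* _)%C; [apply: eq_bigr|apply: big1];
  by move=> s _; rewrite ?mx4E; ring.
(* [hermIm] belongs to the conjugate product, that of b with a; hence the sign. *)
have eAB : hermitian_prod p.1 p.2 = (hermRe x +i* - hermIm x)%C.
  rewrite hermitian_prodE /x quat_of_pairE -sumrN; congr (_ +i* _)%C; apply: eq_bigr;
  by move=> s _; rewrite ?mx4E; ring.
rewrite /stiefelC/= eA eB eAB; split=> [[[->] [->] [-> /eqP]]|[-> -> -> ->]].
  by rewrite oppr_eq0 => /eqP ->.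
by rewrite oppr0.
Qed.

Lemma model_pol3E : model_pol3 n =
  [set x : V | [/\ sqnA x = 1, sqnB x = 1, hermRe x = 0 & hermIm x = 0]].
Proof.
apply/seteqP; split => [_ [p /stiefelCE h <-]//|x xP].
pose p : 'cV[R[i]]_n * 'cV[R[i]]_n :=
  (\col_s (x s 0 +i* x s 1)%C, \col_s (x s 2 +i* x s 3)%C).
have px : quat_of_pair p = x.
  by rewrite quat_of_pairE; apply: mx4_ext => s; rewrite !mx4E !mxE.
by exists p => //; apply/stiefelCE; rewrite px.
Qed.

(** Left multiplication by i moves coordinates 0 and 2 to 1 and 3. On either plane [hermIm] vanishes
    identically, so complex orthonormality is real orthonormality there. *)
Lemma model_pol2E : model_pol2 n = model_pol3 n `&` planar.
Proof.
have E1 (p : 'cV[R]_n * 'cV[R]_n) : quat_of_pair (complexify p.1, complexify p.2) =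
    mx4 (fun s => p.1 s 0) (fun=> 0) (fun s => p.2 s 0) (fun=> 0).
  by rewrite quat_of_pairE; apply: mx4_ext => s; rewrite !mx4E !mxE.
have E2 (p : 'cV[R]_n * 'cV[R]_n) :
    quat_of_pair ('i%C *: complexify p.1, 'i%C *: complexify p.2) =
    mx4 (fun=> 0) (fun s => p.1 s 0) (fun=> 0) (fun s => p.2 s 0).
  rewrite quat_of_pairE; apply: mx4_ext => s; rewrite !mx4E !mxE /=.
  by split; ring.
rewrite model_pol3E; apply/seteqP; split => x /=.
- move=> [] [p [p1 p2 p12] <-]; rewrite ?E1 ?E2; split.
  + split; [apply: etrans p1|apply: etrans p2|apply: etrans p12|apply: big1 => s _; rewrite !mx4E; ring];
    by apply: eq_bigr => s _; rewrite !mx4E; ring.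
  + by left=> s; rewrite !mx4E.
  + split; [apply: etrans p1|apply: etrans p2|apply: etrans p12|apply: big1 => s _; rewrite !mx4E; ring];
    by apply: eq_bigr => s _; rewrite !mx4E; ring.
  + by right=> s; rewrite !mx4E.
- move=> [[xA xB xr xi] [xp|xp]]; [left|right].
  + exists (\col_s x s 0, \col_s x s 2).
      split; [apply: etrans xA|apply: etrans xB|apply: etrans xr]; apply: eq_bigr => s _;
      by have [x1 x3] := xp s; rewrite !mxE ?x1 ?x3; ring.
    rewrite E1; apply: mx4_ext => s; rewrite !mx4E !mxE.
    by have [-> ->] := xp s.
  + exists (\col_s x s 1, \col_s x s 3).
      split; [apply: etrans xA|apply: etrans xB|apply: etrans xr]; apply: eq_bigr => s _;
      by have [x1 x3] := xp s; rewrite !mxE ?x1 ?x3; ring.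
    rewrite E2; apply: mx4_ext => s; rewrite !mx4E !mxE.
    by have [-> ->] := xp s.
Qed.

End Coordinates.

(** * Charts from affine slices *)

Section Retractions.
Context {R : realType} {n : nat}.
Local Notation V := 'M[R]_(n, 4).
Implicit Types (M B : set V) (J : {set 'I_n * 'I_4}) (base x : V).

Definition slice J base : set V :=
  [set x | forall s c, (s, c) \notin J -> x s c = base s c].

(** [psi] inverts [rho] but is differentiable on an open set of the ambient space, as
    [local_param_chart] requires. [ret_C1] speaks of parametrizations X of the slice because [C1] is
    a notion for functions of row vectors. *)
Record retraction M B J base (rho psi : V -> V) : Prop := Retraction {
  ret_base : forall s c, (s, c) \in J -> base s c = 0;
  ret_open : open B;
  ret_C1 : forall m (X : 'rV[R]_m -> V), (forall s c, C1 (fun u => X u s c)) ->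
    (forall u, slice J base (X u)) -> forall s c, C1 (fun u => rho (X u) s c);
  ret_diff : forall s c x, B x -> differentiable (fun y => psi y s c) x;
  ret_in : forall x, slice J base x -> M (rho x) /\ B (rho x);
  ret_K : forall x, slice J base x -> psi (rho x) = x;
  ret_VK : forall x, M x -> B x -> slice J base (psi x) /\ rho (psi x) = x }.

Lemma retraction_charted M B J base rho psi : retraction M B J base rho psi ->
  charted (m := #|J|) M B.
Proof.
case=> baseJ oB rhoC psiD rhoMB psiK rhoK.
pose idx (i : 'I_#|J|) : 'I_n * 'I_4 := enum_val i.
pose X (u : 'rV[R]_#|J|) : V :=
  \matrix_(s, c) (base s c + \sum_i u 0 i * (idx i == (s, c))%:R).
have Xslice u : slice J base (X u).
  move=> s c scJ; rewrite mxE big1 ?addr0// => i _.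
  have [e|_] := eqVneq (idx i) (s, c); last by rewrite mulr0.
  by rewrite -e /idx enum_valP in scJ.
have Xidx u i : X u (idx i).1 (idx i).2 = u 0 i.
  rewrite mxE baseJ; last by rewrite -surjective_pairing; exact: enum_valP.
  rewrite add0r (bigD1 i)//= -surjective_pairing eqxx mulr1 big1 ?addr0// => j ji.
  by rewrite (inj_eq enum_val_inj) (negPf ji) mulr0.
have XK x : slice J base x -> X (\row_i x (idx i).1 (idx i).2) = x.
  move=> xJ; apply/matrixP => s c; have [scJ|scJ] := boolP ((s, c) \in J); last first.
    by rewrite Xslice// xJ.
  have e : idx (enum_rank_in scJ (s, c)) = (s, c) by exact: enum_rankK_in.
  by have := Xidx (\row_i x (idx i).1 (idx i).2) (enum_rank_in scJ (s, c));
    rewrite mxE e.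
exists setT, (rho \o X).
apply: (@local_param_chart _ _ _ _ M B _ (fun i y => psi y (idx i).1 (idx i).2)).
- apply: rhoC => // s c.
  have -> : (fun u => X u s c) = (fun u => base s c + \sum_i u 0 i * (idx i == (s, c))%:R).
    by apply/funext => u; rewrite mxE.
  apply: C1D; first exact: C1_cst.
  by apply: C1_sum => i; apply: C1M; [exact: C1_coord|exact: C1_cst].
- exact: oB.
- by move=> i x; exact: psiD.
- by move=> u; exact: rhoMB.
- by move=> u i /=; rewrite psiK.
- by move=> x Mx Bx; have [sx rx] := rhoK x Mx Bx; rewrite /= XK.
Qed.

(** A chart that respects R + jR restricts to it by freezing the odd coordinates. As B meets
    [planar] only in that plane, one component is charted; left multiplication by i later carries
    the chart to the other. *)
Lemma retraction_planar M B J base rho psi (J2 := J :&: [set i | (i.2 == 0) || (i.2 == 2)])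
    (L := [set x : V | forall s, x s 1 = 0 /\ x s 3 = 0]) :
  retraction M B J base rho psi ->
  (forall x, L x -> L (rho x)) -> (forall x, L x -> L (psi x)) ->
  L base -> B `&` planar `<=` L ->
  retraction (M `&` planar) B J2 base rho psi.
Proof.
case=> baseJ oB rhoC psiD rhoMB psiK rhoK rhoL psiL baseL BL.
have slice2 x : slice J2 base x <-> slice J base x /\ L x.
  split=> [xJ|[xJ xL] s c].
    split=> [s c scJ|s]; first by apply: xJ; rewrite inE (negPf scJ).
    by split; [apply: etrans (baseL s).1|apply: etrans (baseL s).2]; apply: xJ; rewrite !inE andbF.
  rewrite !inE negb_and => /orP[|]; first exact: xJ.
  by have [x1 x3] := xL s; have [b1 b3] := baseL s; elim/ord4P: c; rewrite ?x1 ?x3 ?b1 ?b3.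
split=> //.
- by move=> s c; rewrite inE => /andP[+ _]; exact: baseJ.
- by move=> m X XC XJ; apply: rhoC => // u; case/slice2: (XJ u).
- move=> x /slice2[xJ xL]; have [Mx Bx] := rhoMB x xJ; split=> //; split=> //.
  by left; exact: rhoL.
- by move=> x /slice2[xJ _]; exact: psiK.
- move=> x [Mx px] Bx; have [sx rx] := rhoK x Mx Bx; split=> //; apply/slice2.
  by split=> //; apply: psiL; exact: BL.
Qed.

Lemma open_pos (f : V -> R) : continuous f -> open [set x | 0 < f x].
Proof.
move=> cf; rewrite -[X in open X]/(f @^-1` [set t | 0 < t]).
by apply: open_comp => // x _; exact: cf.
Qed.

End Retractions.

Section SphereChart.
Context {R : realType} {n : nat}.
Local Notation V := 'M[R]_(n, 4).
Implicit Types (x : V) (s : 'I_n).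

Definition normalize x : V := (Num.sqrt 2 / Num.sqrt (sqnA x + sqnB x)) *: x.

Lemma sqnZ (a : R) x : (sqnA (a *: x) = a ^+ 2 * sqnA x) * (sqnB (a *: x) = a ^+ 2 * sqnB x).
Proof.
by rewrite /sqnA /sqnB !mulr_sumr; split; apply: eq_bigr => s _; rewrite !mxE; ring.
Qed.

Lemma sqnA_ge (x : V) s : x s 0 ^+ 2 + x s 1 ^+ 2 <= sqnA x.
Proof.
rewrite /sqnA (bigD1 s)//= lerDl; apply: sumr_ge0 => t _.
by rewrite addr_ge0// sqr_ge0.
Qed.

Lemma sqnB_ge (x : V) s : x s 2 ^+ 2 + x s 3 ^+ 2 <= sqnB x.
Proof.
rewrite /sqnB (bigD1 s)//= lerDl; apply: sumr_ge0 => t _.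
by rewrite addr_ge0// sqr_ge0.
Qed.

Lemma sqn_gt0 x s : 0 < x s 0 -> 0 < sqnA x.
Proof. by move=> x0; apply: lt_le_trans (sqnA_ge x s); rewrite ltr_pwDl ?exprn_gt0 ?sqr_ge0. Qed.

Lemma sqnB_ge0 x : 0 <= sqnB x.
Proof. by apply: sumr_ge0 => t _; rewrite addr_ge0// sqr_ge0. Qed.

Lemma normalizeZ (a : R) x : 0 < a -> normalize (a *: x) = normalize x.
Proof.
move=> a0; rewrite /normalize !sqnZ -mulrDr scalerA sqrtrM ?sqr_ge0//.
rewrite sqrtr_sqr gtr0_norm// invfM; congr (_ *: _).
by rewrite mulrCA mulrAC mulVf ?mul1r// gt_eqF.
Qed.

(** Central projection between an open half-sphere and the affine hyperplane where the entry (s0, 0)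
    equals 1. Normalization ignores positive factors, so the two maps are mutually inverse. *)
Lemma sphere_retraction s0 : retraction (sphere n) [set x : V | 0 < x s0 0]
  (~: [set (s0, 0)]) (delta_mx s0 0) normalize (fun x => (x s0 0)^-1 *: x).
Proof.
have slice0 x : slice (~: [set (s0, 0)]) (delta_mx s0 0) x -> x s0 0 = 1.
  by move=> ->; rewrite ?inE ?eqxx// mxE !eqxx.
split.
- move=> s c; rewrite !inE => sc0; rewrite mxE.
  by move: sc0; rewrite xpair_eqE => /negPf ->.
- by apply: open_pos; exact: coord_continuous.
- move=> m X XC Xs s c.
  rewrite /normalize; under eq_fun do rewrite mxE.
  apply: C1M => //; apply: C1M; first exact: C1_cst.
  apply: C1_invsqrt => [|u]; last first.
    by rewrite ltr_pwDl ?sqnB_ge0// (@sqn_gt0 _ s0)// slice0.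
  by apply: C1D; apply: C1_sum => t; apply: C1D; rewrite /=; under eq_fun do rewrite expr2; exact: C1M.
- move=> s c x /= x0; under eq_fun do rewrite mxE.
  apply: differentiableM; last exact: differentiable_coord.
  by apply: differentiableV; [exact: differentiable_coord|rewrite gt_eqF].
- move=> x /slice0 x0.
  have N0 : 0 < sqnA x + sqnB x by rewrite ltr_pwDl ?sqnB_ge0// (@sqn_gt0 _ s0)// x0.
  rewrite sphereE; split=> /=.
    rewrite /normalize !sqnZ -mulrDr expr_div_n !sqr_sqrtr ?ler0n ?(ltW N0)//.
    by rewrite -mulrA mulVf ?mulr1// gt_eqF.
  by rewrite mxE x0 mulr1 divr_gt0// sqrtr_gt0.
- move=> x /slice0 x0.
  have N0 : 0 < sqnA x + sqnB x by rewrite ltr_pwDl ?sqnB_ge0// (@sqn_gt0 _ s0)// x0.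
  rewrite /normalize mxE x0 mulr1 scalerA mulVf ?scale1r// gt_eqF//.
  by rewrite divr_gt0// sqrtr_gt0.
- move=> x; rewrite sphereE /= => xN x0; split.
    move=> s c; rewrite !inE negbK => /eqP[-> ->].
    by rewrite !mxE !eqxx/= mulVf// gt_eqF.
  by rewrite normalizeZ ?invr_gt0// /normalize xN divff ?scale1r// gt_eqF// sqrtr_gt0.
Qed.

End SphereChart.

Section DifferentiabilityRules.
Context {R : realType} {n d : nat}.
Local Notation V := 'M[R]_(n, d).

Lemma differentiable_mulr (f g : V -> R) (x : V) : differentiable f x -> differentiable g x ->
  differentiable (fun y => f y * g y) x.
Proof. exact: differentiableM. Qed.

Lemma differentiable_addr (f g : V -> R) (x : V) : differentiable f x -> differentiable g x ->
  differentiable (fun y => f y + g y) x.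
Proof. exact: differentiableD. Qed.

Lemma differentiable_oppr (f : V -> R) (x : V) : differentiable f x ->
  differentiable (fun y => - f y) x.
Proof. exact: differentiableN. Qed.

End DifferentiabilityRules.

Ltac diff_tac := repeat lazymatch goal with
  | |- differentiable (fun _ => ?a) _ => exact: differentiable_cst
  | |- differentiable (fun y => @?f y + @?g y) _ => apply: (@differentiable_addr _ _ _ f g)
  | |- differentiable (fun y => @?f y * @?g y) _ => apply: (@differentiable_mulr _ _ _ f g)
  | |- differentiable (fun y => - @?f y) _ => apply: (@differentiable_oppr _ _ _ f)
  | |- differentiable (fun y => @?f y ^+ 2) _ => apply: (@differentiable_mulr _ _ _ f f)
  | |- differentiable (fun y => fun_of_matrix y _ _) _ => exact: differentiable_coord
  end.

Ltac C1_tac := repeat lazymatch goal with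
  | |- C1 (fun _ => ?a) => exact: C1_cst
  | |- C1 (fun u => @?f u + @?g u) => apply: (@C1D _ _ f g)
  | |- C1 (fun u => @?f u * @?g u) => apply: (@C1M _ _ f g)
  | |- C1 (fun u => - @?f u) => apply: (@C1N _ _ f)
  | |- C1 (fun u => @?f u ^+ 2) => apply: (@C1M _ _ f f)
  end.

(** * Gram-Schmidt charts of the Stiefel manifold *)

Section StiefelChart.
Context {R : realType} {n : nat}.
Local Notation V := 'M[R]_(n, 4).
Implicit Types (x : V) (s : 'I_n).

(* In terms of x = (a, b), the pair (p a, t b + (r + r' i) a). *)
Definition triang (p t r r' : R) x : V :=
  mx4 (fun s => p * x s 0) (fun s => p * x s 1)
      (fun s => t * x s 2 + (r * x s 0 - r' * x s 1))
      (fun s => t * x s 3 + (r * x s 1 + r' * x s 0)).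

Lemma sqnA_triang p t r r' x : sqnA (triang p t r r' x) = p ^+ 2 * sqnA x.
Proof. by rewrite /sqnA mulr_sumr; apply: eq_bigr => s _; rewrite !mx4E; ring. Qed.

Lemma hermRe_triang p t r r' x :
  hermRe (triang p t r r' x) = p * (t * hermRe x + r * sqnA x).
Proof.
rewrite /sqnA /hermRe !mulr_sumr -big_split mulr_sumr /=; apply: eq_bigr => s _.
by rewrite !mx4E; ring.
Qed.

Lemma hermIm_triang p t r r' x :
  hermIm (triang p t r r' x) = p * (t * hermIm x + r' * sqnA x).
Proof.
rewrite /sqnA /hermIm !mulr_sumr -big_split mulr_sumr /=; apply: eq_bigr => s _.
by rewrite !mx4E; ring.
Qed.

(** The second vector is |a|^2 b - <b, a> a, the component of b orthogonal to a multiplied by |a|^2;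
    clearing the denominator keeps it polynomial. *)
Definition gs_resid x : V := triang 1 (sqnA x) (- hermRe x) (- hermIm x) x.

Definition gram_schmidt x : V :=
  triang (Num.sqrt (sqnA x))^-1 (Num.sqrt (sqnB (gs_resid x)))^-1 0 0 (gs_resid x).

Lemma triang_comp p t r r' p' t' r2 r2' x :
  triang p t r r' (triang p' t' r2 r2' x) =
  triang (p * p') (t * t') (t * r2 + r * p') (t * r2' + r' * p') x.
Proof. by apply: mx4_ext => s; rewrite !mx4E; split; ring. Qed.

Lemma triang1 x : triang 1 1 0 0 x = x.
Proof. by apply: mx4_ext => s; rewrite !mx4E; split; ring. Qed.

Lemma sqnB_triang p t x : sqnB (triang p t 0 0 x) = t ^+ 2 * sqnB x.
Proof. by rewrite /sqnB mulr_sumr; apply: eq_bigr => s _; rewrite !mx4E; ring. Qed.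

Lemma gs_resid_triang p t r r' x :
  gs_resid (triang p t r r' x) = triang p (p ^+ 2 * t) 0 0 (gs_resid x).
Proof.
rewrite /gs_resid sqnA_triang hermRe_triang hermIm_triang !triang_comp.
by apply: mx4_ext => s; rewrite !mx4E; split; ring.
Qed.

(** A triangular change with positive diagonal multiplies a by p and the residual by p^2 t, and both
    factors disappear on normalizing. *)
Lemma gram_schmidt_triang p t r r' x : 0 < p -> 0 < t ->
  gram_schmidt (triang p t r r' x) = gram_schmidt x.
Proof.
move=> p0 t0; have pt0 : 0 < p ^+ 2 * t by rewrite mulr_gt0// exprn_gt0.
rewrite /gram_schmidt gs_resid_triang sqnA_triang sqnB_triang triang_comp.
rewrite (sqrtrM _ (sqr_ge0 p)) (sqrtrM _ (sqr_ge0 (p ^+ 2 * t))) !sqrtr_sqr.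
rewrite (gtr0_norm p0) (gtr0_norm pt0).
by rewrite !mulr0 !mul0r addr0; congr triang; rewrite invfM mulrAC mulVf ?mul1r// gt_eqF.
Qed.

Lemma gram_schmidt_id x : model_pol3 n x -> gram_schmidt x = x.
Proof.
rewrite model_pol3E => -[xA xB xr xi].
have e : gs_resid x = x by rewrite /gs_resid xA xr xi !oppr0 triang1.
by rewrite /gram_schmidt e xA xB sqrtr1 invr1 triang1.
Qed.

Lemma gram_schmidt_stiefel x : 0 < sqnA x -> 0 < sqnB (gs_resid x) ->
  model_pol3 n (gram_schmidt x).
Proof.
move=> A0 B0; have gA : sqnA (gs_resid x) = sqnA x by rewrite sqnA_triang expr1n mul1r.
rewrite model_pol3E /gram_schmidt; split.
- by rewrite sqnA_triang gA exprVn sqr_sqrtr ?(ltW A0)// mulVf// gt_eqF.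
- by rewrite sqnB_triang exprVn sqr_sqrtr ?(ltW B0)// mulVf// gt_eqF.
- by rewrite hermRe_triang gA hermRe_triang; ring.
- by rewrite hermIm_triang gA hermIm_triang; ring.
Qed.

Variables s0 s1 : 'I_n.
Hypothesis s01 : s0 != s1.

(* The multiple |a_s0|^2 b - b_s0 conj(a_s0) a of b modulo a, whose s0-th entry vanishes. *)
Definition row_resid x : V :=
  triang 1 (x s0 0 ^+ 2 + x s0 1 ^+ 2) (- (x s0 2 * x s0 0 + x s0 3 * x s0 1))
    (- (x s0 3 * x s0 0 - x s0 2 * x s0 1)) x.

(** Another representative of the orbit of x under positive triangular changes: Re a_s0 = 1, b_s0 =
    0 and Re b_s1 = 1. *)
Definition pivot_normalize x : V := triang (x s0 0)^-1 (row_resid x s1 2)^-1 0 0 (row_resid x).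

Definition pivot_dom : set V := [set x : V | 0 < x s0 0 /\ 0 < row_resid x s1 2].

(** The four removed entries are those prescribed by [pivot_normalize], one for each real parameter
    of [triang]. *)
Definition pivot_slice : {set 'I_n * 'I_4} := ~: [set (s0, 0); (s0, 2); (s0, 3); (s1, 2)].

Lemma row_resid_triang p t r r' x :
  row_resid (triang p t r r' x) = triang p (p ^+ 2 * t) 0 0 (row_resid x).
Proof.
rewrite /row_resid; apply: mx4_ext => s; rewrite !triang_comp !mx4E; split; ring.
Qed.

Lemma pivot_normalize_triang p t r r' x : 0 < p -> 0 < t ->
  pivot_normalize (triang p t r r' x) = pivot_normalize x.
Proof.
move=> p0 t0; have pt0 : 0 < p ^+ 2 * t by rewrite mulr_gt0// exprn_gt0.
rewrite /pivot_normalize row_resid_triang triang_comp !mulr0 !mul0r addr0.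
by congr triang; rewrite !mx4E ?mul0r ?subr0 ?addr0 invfM mulrAC mulVf ?mul1r// gt_eqF.
Qed.

Lemma pivot_dom_triang p t r r' x : 0 < p -> 0 < t -> pivot_dom x ->
  pivot_dom (triang p t r r' x).
Proof.
move=> p0 t0 [x0 x1]; split; first by rewrite mx4E mulr_gt0.
by rewrite row_resid_triang mx4E !mul0r subr0 addr0 mulr_gt0// mulr_gt0// exprn_gt0.
Qed.

Lemma slice_pivot x : slice pivot_slice (delta_mx s0 0 + delta_mx s1 2) x <->
  [/\ x s0 0 = 1, x s0 2 = 0, x s0 3 = 0 & x s1 2 = 1].
Proof.
have s10 : (s1 == s0) = false by rewrite eq_sym; exact: negPf.
split=> [xJ|[x00 x02 x03 x12] s c].
  by split; rewrite xJ ?inE ?eqxx ?orbT// !mxE !eqxx ?(negPf s01) ?s10 /=; ring.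
rewrite !inE negbK !xpair_eqE -!orbA.
by case/or4P => /andP[/eqP-> /eqP->]; rewrite !mxE ?eqxx ?(negPf s01) ?s10 /=
  ?x00 ?x02 ?x03 ?x12; ring.
Qed.

Lemma slice_pivot_dom x : slice pivot_slice (delta_mx s0 0 + delta_mx s1 2) x ->
  [/\ pivot_dom x, 0 < sqnA x & 0 < sqnB (gs_resid x)].
Proof.
move=> /slice_pivot[x00 x02 x03 x12].
have A0 : 0 < sqnA x by apply: (@sqn_gt0 _ _ _ s0); rewrite x00.
have dx : pivot_dom x.
  split; first by rewrite x00.
  rewrite mx4E x00 x02 x03 x12 mulr1 !mul0r addr0 subr0 oppr0 !mul0r subr0 addr0.
  by rewrite expr1n ltr_pwDl// sqr_ge0.
(* If the second vector of [gs_resid x] were 0, its [row_resid] entry at s1 would vanish. But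
   [gs_resid x] is a positive triangular image of x, hence lies in [pivot_dom]. *)
split=> //; rewrite lt_neqAle sqnB_ge0 andbT eq_sym; apply/eqP => g0.
have /(pivot_dom_triang (- hermRe x) (- hermIm x) (ltr01) A0)[_] := dx.
have z s : gs_resid x s 2 = 0 /\ gs_resid x s 3 = 0.
  have := sqnB_ge (gs_resid x) s; rewrite g0 => h.
  have h' : gs_resid x s 2 ^+ 2 + gs_resid x s 3 ^+ 2 == 0.
    by rewrite eq_le h addr_ge0// sqr_ge0.
  by move: h'; rewrite paddr_eq0 ?sqr_ge0// !sqrf_eq0 => /andP[/eqP-> /eqP->].
rewrite -/(gs_resid x) mx4E.
have [-> _] := z s1; have [-> ->] := z s0.
by rewrite mulr0 !mul0r addr0 subr0 oppr0 !mul0r subr0 addr0 ltxx.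
Qed.

Lemma row_resid_differentiable s c x : differentiable (fun y => row_resid y s c) x.
Proof. by elim/ord4P: c; under eq_fun do rewrite mx4E; diff_tac. Qed.

(** [gram_schmidt] and [pivot_normalize] choose two representatives in the same orbit of the
    positive triangular group, and each is constant on orbits; therefore they invert each other. *)
Lemma stiefel_retraction : retraction (model_pol3 n) pivot_dom pivot_slice
  (delta_mx s0 0 + delta_mx s1 2) gram_schmidt pivot_normalize.
Proof.
have s10 : (s1 == s0) = false by rewrite eq_sym; exact: negPf.
split.
- move=> s c; rewrite !inE => scJ; rewrite !mxE; move: scJ.
  rewrite !xpair_eqE -!orbA !negb_or => /and4P[/negPf-> _ _ /negPf->].
  by rewrite addr0.
- apply: openI; first by apply: open_pos; exact: coord_continuous.
  by apply: open_pos => x; exact: differentiable_continuous (row_resid_differentiable _ _ _).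
- move=> m X XC Xs s c.
  have CA : C1 (fun u => sqnA (X u)).
    by rewrite /sqnA; apply: C1_sum => t; C1_tac; exact: XC.
  have CR : C1 (fun u => hermRe (X u)).
    by rewrite /hermRe; apply: C1_sum => t; C1_tac; exact: XC.
  have CI : C1 (fun u => hermIm (X u)).
    by rewrite /hermIm; apply: C1_sum => t; C1_tac; exact: XC.
  have CG t d : C1 (fun u => gs_resid (X u) t d).
    by elim/ord4P: d; under eq_fun do rewrite mx4E; C1_tac;
      by lazymatch goal with |- C1 (fun u => fun_of_matrix _ _ _) => exact: XC | |- _ => assumption end.
  have CB : C1 (fun u => sqnB (gs_resid (X u))).
    by rewrite /sqnB; apply: C1_sum => t; C1_tac; exact: CG.
  have CA' : C1 (fun u => (Num.sqrt (sqnA (X u)))^-1).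
    by apply: C1_invsqrt => // u; have [] := slice_pivot_dom (Xs u).
  have CB' : C1 (fun u => (Num.sqrt (sqnB (gs_resid (X u))))^-1).
    by apply: C1_invsqrt => // u; have [] := slice_pivot_dom (Xs u).
  by elim/ord4P: c; under eq_fun do rewrite mx4E; C1_tac;
    by lazymatch goal with |- C1 (fun u => fun_of_matrix _ _ _) => exact: CG | |- _ => assumption end.
- move=> s c x [x0 x1].
  have D0 : differentiable (fun y : V => (y s0 0)^-1) x.
    by apply: differentiableV; [exact: differentiable_coord|rewrite gt_eqF].
  have D1 : differentiable (fun y : V => (row_resid y s1 2)^-1) x.
    by apply: differentiableV; [exact: row_resid_differentiable|rewrite gt_eqF].
  by elim/ord4P: c; under eq_fun do rewrite mx4E; diff_tac;
    by lazymatch goal with |- differentiable (fun y => fun_of_matrix _ _ _) _ =>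
      exact: row_resid_differentiable | |- _ => assumption end.
- move=> x /slice_pivot_dom[dx A0 B0]; split; first exact: gram_schmidt_stiefel.
  rewrite /gram_schmidt /gs_resid triang_comp.
  apply: pivot_dom_triang dx; rewrite ?mulr1 ?mulr_gt0 ?invr_gt0 ?sqrtr_gt0//.
- move=> x xs; have [dx A0 B0] := slice_pivot_dom xs.
  have /slice_pivot[x00 x02 x03 x12] := xs.
  rewrite /gram_schmidt /gs_resid triang_comp pivot_normalize_triang; last 2 first.
  + by rewrite mulr1 invr_gt0 sqrtr_gt0.
  + by rewrite mulr_gt0// invr_gt0 sqrtr_gt0.
  rewrite /pivot_normalize x00 /row_resid x00 x02 x03 !mulr1 !mul0r subr0 addr0 oppr0.
  rewrite triang_comp mx4E x12 invr1 !mulr1 !mul0r !mulr0 subr0 !addr0 mulVf ?triang1//.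
  by rewrite expr1n gt_eqF// ltr_pwDl// sqr_ge0.
- move=> x Mx [x0 x1]; split.
    apply/slice_pivot; rewrite !mx4E !mul0r !subr0 !addr0; split.
    + by rewrite mul1r mulVf// gt_eqF.
    + by move: (_^-1) => d; ring.
    + by move: (_^-1) => d; ring.
    + by move: x1; rewrite mx4E => x1; rewrite mulVf// gt_eqF.
  rewrite {1}/pivot_normalize {2}/row_resid triang_comp gram_schmidt_triang ?gram_schmidt_id//.
    by rewrite mulr1 invr_gt0.
  by rewrite mulr_gt0 ?invr_gt0// ltr_pwDl ?exprn_gt0// sqr_ge0.
Qed.

End StiefelChart.

(** * Symmetries of the model spaces *)

Section RowForms.
Context {R : realType}.
Implicit Types (r t : 'rV[R]_4) (w : quaternion R).

Definition rdot r t : R := r 0 0 * t 0 0 + r 0 1 * t 0 1 + r 0 2 * t 0 2 + r 0 3 * t 0 3.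
(** The contributions of one row to [sqnA], [sqnB], [hermRe] and [hermIm]; they are also, up to
    factors, the building blocks of the Hopf coordinates. *)
Definition formA r : R := r 0 0 ^+ 2 + r 0 1 ^+ 2.
Definition formB r : R := r 0 2 ^+ 2 + r 0 3 ^+ 2.
Definition formRe r : R := r 0 2 * r 0 0 + r 0 3 * r 0 1.
Definition formIm r : R := r 0 3 * r 0 0 - r 0 2 * r 0 1.
Definition planar1 r := r 0 1 = 0 /\ r 0 3 = 0.
Definition planar2 r := r 0 0 = 0 /\ r 0 2 = 0.

Lemma row4_ext r t : r 0 0 = t 0 0 -> r 0 1 = t 0 1 -> r 0 2 = t 0 2 -> r 0 3 = t 0 3 -> r = t.
Proof. by move=> *; apply/rowP; exact: ord4P. Qed.

(** Multiplication is on the left because w(a + b j) = wa + (wb) j for complex w: both vectors of a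
    pair are then multiplied by the same scalar. *)
Definition lq w r : 'rV[R]_4 := row_of_quat (qmul w (quat_of_row r)).

Lemma row_of_quatE w : ((row_of_quat w 0 0 = q1 w) * (row_of_quat w 0 1 = qi w)) *
  ((row_of_quat w 0 2 = qj w) * (row_of_quat w 0 3 = qk w)).
Proof. by do !split; rewrite mxE. Qed.

Definition qnorm2 w : R := q1 w ^+ 2 + qi w ^+ 2 + qj w ^+ 2 + qk w ^+ 2.

(* On C^2 = H: (a, b) |-> (a, i b). *)
Definition phaseB r : 'rV[R]_4 := row_of_quat (Quat (r 0 0) (r 0 1) (- r 0 3) (r 0 2)).
Definition phaseBV r : 'rV[R]_4 := row_of_quat (Quat (r 0 0) (r 0 1) (r 0 3) (- r 0 2)).

Definition mixl w r t : 'rV[R]_4 := (Num.sqrt 2)^-1 *: (r + lq w t).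
Definition mixr w r t : 'rV[R]_4 := (Num.sqrt 2)^-1 *: (t - lq (qconj w) r).
Definition qopp w : quaternion R := Quat (- q1 w) (- qi w) (- qj w) (- qk w).

Lemma invsqrt2_sqr : (Num.sqrt (2 : R))^-1 ^+ 2 = 2^-1.
Proof. by rewrite exprVn sqr_sqrtr// ler0n. Qed.

Lemma rdot_lq w r t : rdot (lq w r) (lq w t) = qnorm2 w * rdot r t.
Proof. by rewrite /rdot !row_of_quatE /qnorm2 /=; ring. Qed.

Lemma lq_linear w : linear (lq w).
Proof. by move=> a r t; apply: row4_ext; rewrite !mxE /= !mxE; ring. Qed.

Lemma mix_linear w a r t r' t' :
  mixl w (a *: r + r') (a *: t + t') = a *: mixl w r t + mixl w r' t' /\
  mixr w (a *: r + r') (a *: t + t') = a *: mixr w r t + mixr w r' t'.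
Proof. by split; apply: row4_ext; rewrite !mxE /= !mxE; ring. Qed.

(** The matrix with rows (1, w) and (-conj(w), 1), divided by sqrt 2, is unitary, and its conjugate
    transpose is the same matrix for -w. *)
Lemma mixK w r t : qnorm2 w = 1 ->
  mixl (qopp w) (mixl w r t) (mixr w r t) = r /\ mixr (qopp w) (mixl w r t) (mixr w r t) = t.
Proof.
(* Inserting this expression for 1 on the right turns the goal into a polynomial identity in the
   inverse of sqrt 2 and the entries. *)
move=> w1; have cc : (Num.sqrt (2 : R))^-1 ^+ 2 * (1 + qnorm2 w) = 1.
  by rewrite invsqrt2_sqr w1 -[1 + 1]/(2 : R) mulVf// pnatr_eq0.
split; rewrite -[RHS]scale1r -cc /qnorm2; apply: row4_ext; do 4 rewrite ?mxE /=; ring.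
Qed.

Lemma mix_rdot w r t r' t' : qnorm2 w = 1 ->
  rdot (mixl w r t) (mixl w r' t') + rdot (mixr w r t) (mixr w r' t') = rdot r r' + rdot t t'.
Proof.
move=> w1; have cc : (Num.sqrt (2 : R))^-1 ^+ 2 * (1 + qnorm2 w) = 1.
  by rewrite invsqrt2_sqr w1 -[1 + 1]/(2 : R) mulVf// pnatr_eq0.
rewrite -[RHS]mul1r -cc /qnorm2 /rdot; do 3 rewrite ?mxE /=; ring.
Qed.

(** For complex w the change of rows lies in U(2) and acts alike on a and b, so it keeps their
    Hermitian products; a j-component would mingle a with b. *)
Lemma mix_forms w r t : qnorm2 w = 1 -> qj w = 0 -> qk w = 0 ->
  [/\ formA (mixl w r t) + formA (mixr w r t) = formA r + formA t,
      formB (mixl w r t) + formB (mixr w r t) = formB r + formB t,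
      formRe (mixl w r t) + formRe (mixr w r t) = formRe r + formRe t &
      formIm (mixl w r t) + formIm (mixr w r t) = formIm r + formIm t].
Proof.
move=> w1 wj wk; have cc : (Num.sqrt (2 : R))^-1 ^+ 2 * (1 + qnorm2 w) = 1.
  by rewrite invsqrt2_sqr w1 -[1 + 1]/(2 : R) mulVf// pnatr_eq0.
by split; rewrite -[RHS]mul1r -cc /qnorm2 /formA /formB /formRe /formIm; do 3 rewrite ?mxE /=; rewrite wj wk; ring.
Qed.

End RowForms.

Section RowOperations.
Context {R : realType} {n : nat}.
Local Notation V := 'M[R]_(n, 4).
Implicit Types (x y : V) (M : set V).

Definition rowwise (f : 'rV[R]_4 -> 'rV[R]_4) x : V := \matrix_(s < n) f (row s x).

Definition on_rows (m l : 'I_n) (p q : 'rV[R]_4 -> 'rV[R]_4 -> 'rV[R]_4) x : V :=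
  \matrix_(s < n) (if s == m then p (row m x) (row l x)
                   else if s == l then q (row m x) (row l x) else row s x).

Lemma mxdotE x y : mxdot x y = \sum_s rdot (row s x) (row s y).
Proof. by apply: eq_bigr => s _; rewrite sum_ord4 /rdot !mxE. Qed.

Lemma linear_rowP x y z (a : R) :
  (forall s, row s z = a *: row s x + row s y) -> z = a *: x + y.
Proof. by move=> h; apply/row_matrixP => s; rewrite h linearP. Qed.

Lemma row_rowwise f x s : row s (rowwise f x) = f (row s x).
Proof. exact: rowK. Qed.

Lemma row_on_rows m l p q x s : row s (on_rows m l p q x) =
  if s == m then p (row m x) (row l x) else if s == l then q (row m x) (row l x) else row s x.
Proof. exact: rowK. Qed.

Lemma rowwise_symmetry M f f' : linear f -> cancel f f' -> cancel f' f ->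
  (forall r t, rdot (f r) (f t) = rdot r t) ->
  (forall x, M x -> M (rowwise f x)) -> (forall x, M x -> M (rowwise f' x)) ->
  symmetry M (rowwise f) (rowwise f').
Proof.
move=> fL fK fVK fd fM fVM; split => //.
- move=> a x y; apply: linear_rowP => s.
  by rewrite !row_rowwise -fL linearP.
- by move=> x; apply/row_matrixP => s; rewrite !row_rowwise fK.
- by move=> x; apply/row_matrixP => s; rewrite !row_rowwise fVK.
- by move=> x y; rewrite !mxdotE; apply: eq_bigr => s _; rewrite !row_rowwise fd.
Qed.

Section PairOfRows.
Variables (m l : 'I_n).
Hypothesis ml : m != l.

Lemma sum_on_rows (F : 'rV[R]_4 -> 'rV[R]_4 -> R) p q x y :
  F (p (row m x) (row l x)) (p (row m y) (row l y)) +
    F (q (row m x) (row l x)) (q (row m y) (row l y)) =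
  F (row m x) (row m y) + F (row l x) (row l y) ->
  \sum_s F (row s (on_rows m l p q x)) (row s (on_rows m l p q y)) =
  \sum_s F (row s x) (row s y).
Proof.
have lm : (l == m) = false by rewrite eq_sym (negPf ml).
move=> h; rewrite (bigD1 m)// (bigD1 l)/=; last by rewrite lm.
rewrite [RHS](bigD1 m)// [in RHS](bigD1 l)/=; last by rewrite lm.
rewrite !row_on_rows !eqxx lm !addrA h; congr (_ + _); apply: eq_bigr => s /andP[sm sl].
by rewrite !row_on_rows (negPf sm) (negPf sl).
Qed.

Lemma sum_on_rows1 (F : 'rV[R]_4 -> R) p q x :
  F (p (row m x) (row l x)) + F (q (row m x) (row l x)) = F (row m x) + F (row l x) ->
  \sum_s F (row s (on_rows m l p q x)) = \sum_s F (row s x).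
Proof. exact: (@sum_on_rows (fun r _ => F r) p q x x). Qed.

Lemma on_rows_symmetry M p q p' q' :
  (forall a r t r' t', p (a *: r + r') (a *: t + t') = a *: p r t + p r' t' /\
                       q (a *: r + r') (a *: t + t') = a *: q r t + q r' t') ->
  (forall r t, p' (p r t) (q r t) = r /\ q' (p r t) (q r t) = t) ->
  (forall r t, p (p' r t) (q' r t) = r /\ q (p' r t) (q' r t) = t) ->
  (forall r t r' t', rdot (p r t) (p r' t') + rdot (q r t) (q r' t') = rdot r r' + rdot t t') ->
  (forall x, M x -> M (on_rows m l p q x)) -> (forall x, M x -> M (on_rows m l p' q' x)) ->
  symmetry M (on_rows m l p q) (on_rows m l p' q').
Proof.
have lm : (l == m) = false by rewrite eq_sym (negPf ml).
move=> pqL pqK pqVK pqd pqM pqVM.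
have K p1 q1 p2 q2 : (forall r t, p2 (p1 r t) (q1 r t) = r /\ q2 (p1 r t) (q1 r t) = t) ->
    cancel (on_rows m l p1 q1) (on_rows m l p2 q2).
  move=> h x; apply/row_matrixP => s; rewrite !row_on_rows !eqxx lm.
  have [-> ->] := h (row m x) (row l x).
  by have [->//|_] := eqVneq s m; have [->//|_] := eqVneq s l.
split => //; [|exact: K|exact: K|].
- move=> a x y; apply: linear_rowP => s.
  have rowD t : row t (a *: x + y) = a *: row t x + row t y by rewrite linearP.
  rewrite !row_on_rows !rowD.
  have [-> ->] := pqL a (row m x) (row l x) (row m y) (row l y).
  by case: (s == m) => //; case: (s == l).
- by move=> x y; rewrite !mxdotE (@sum_on_rows rdot)// pqd.
Qed.

End PairOfRows.

Lemma model_arm3_mxdot x : sphere n x <-> mxdot x x = 2.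
Proof.
rewrite sphereE /=; suff -> : sqnA x + sqnB x = mxdot x x by [].
rewrite mxdotE /sqnA /sqnB -big_split/=; apply: eq_bigr => s _.
by rewrite /rdot !mxE; ring.
Qed.

(** The sphere is a level set of [mxdot], so every linear isometry qualifies; M serves only to
    supply one and is [setT] below. *)
Lemma symmetry_sphere M T S : symmetry M T S -> symmetry (sphere n) T S.
Proof.
move=> sT; have sS := symmetryV sT.
case: sT sS => TL TS ST Td _ _ [_ _ _ Sd _ _].
by split=> // x; rewrite !model_arm3_mxdot ?Td ?Sd.
Qed.

Lemma model_pol3_forms x : model_pol3 n x <->
  [/\ \sum_s formA (row s x) = 1, \sum_s formB (row s x) = 1,
      \sum_s formRe (row s x) = 0 & \sum_s formIm (row s x) = 0].
Proof.
have E (F G : 'I_n -> R) : F =1 G -> \sum_s F s = \sum_s G s.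
  by move=> FG; apply: eq_bigr => s _; exact: FG.
rewrite model_pol3E /= /sqnA /sqnB /hermRe /hermIm.
have -> : \sum_s formA (row s x) = \sum_s (x s 0 ^+ 2 + x s 1 ^+ 2).
  by apply: E => s; rewrite /formA !mxE.
have -> : \sum_s formB (row s x) = \sum_s (x s 2 ^+ 2 + x s 3 ^+ 2).
  by apply: E => s; rewrite /formB !mxE.
have -> : \sum_s formRe (row s x) = \sum_s (x s 2 * x s 0 + x s 3 * x s 1).
  by apply: E => s; rewrite /formRe !mxE.
have -> : \sum_s formIm (row s x) = \sum_s (x s 3 * x s 0 - x s 2 * x s 1).
  by apply: E => s; rewrite /formIm !mxE.
by [].
Qed.

Lemma planarE x : planar x <->
  (forall s, planar1 (row s x)) \/ (forall s, planar2 (row s x)).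
Proof.
by split=> -[h|h]; [left|right|left|right] => s; have := h s; rewrite /planar1 /planar2 !mxE.
Qed.

Lemma rowwise_planar f x :
  (forall r, planar1 r -> planar1 (f r)) /\ (forall r, planar2 r -> planar2 (f r)) \/
  (forall r, planar1 r -> planar2 (f r)) /\ (forall r, planar2 r -> planar1 (f r)) ->
  planar x -> planar (rowwise f x).
Proof.
rewrite !planarE => -[[h1 h2]|[h1 h2]] [p|p]; [left|right|right|left] => s;
  by rewrite row_rowwise; auto.
Qed.

Lemma on_rows_planar m l p q x :
  (forall r t, planar1 r -> planar1 t -> planar1 (p r t) /\ planar1 (q r t)) ->
  (forall r t, planar2 r -> planar2 t -> planar2 (p r t) /\ planar2 (q r t)) ->
  planar x -> planar (on_rows m l p q x).
Proof.
rewrite !planarE => h1 h2 [h|h]; [left|right] => s; rewrite row_on_rows;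
  [have [? ?] := h1 _ _ (h m) (h l)|have [? ?] := h2 _ _ (h m) (h l)];
  by case: ifP => // _; case: ifP.
Qed.

End RowOperations.

Section ModelSymmetries.
Context {R : realType} {n : nat}.
Local Notation V := 'M[R]_(n, 4).
Implicit Types (x y : V) (M : set V) (w : quaternion R).

Definition mix (m l : 'I_n) w : V -> V := on_rows m l (mixl w) (mixr w).
Definition swap (m l : 'I_n) : V -> V := on_rows m l (fun _ t => t) (fun r _ => r).
Definition lq_row (m l : 'I_n) w : V -> V := on_rows m l (fun r _ => lq w r) (fun _ t => t).

Lemma lqK w (r : 'rV[R]_4) : qnorm2 w = 1 -> lq (qconj w) (lq w r) = r /\ lq w (lq (qconj w) r) = r.
Proof.
move=> w1; split; rewrite -[RHS]scale1r -w1 /qnorm2; apply: row4_ext;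
  do 4 rewrite ?mxE /=; ring.
Qed.

Lemma qnorm2_opp w : qnorm2 (qopp w) = qnorm2 w.
Proof. by rewrite /qnorm2 /= !sqrrN. Qed.

Lemma qoppK w : qopp (qopp w) = w.
Proof. by case: w => a b c d; rewrite /qopp /= !opprK. Qed.

Section Pairs.
Variables m l : 'I_n.
Hypothesis ml : m != l.

Lemma mix_symmetry M w : qnorm2 w = 1 ->
  (forall x, M x -> M (mix m l w x)) -> (forall x, M x -> M (mix m l (qopp w) x)) ->
  symmetry M (mix m l w) (mix m l (qopp w)).
Proof.
move=> w1 wM wVM; apply: on_rows_symmetry => //.
- exact: mix_linear.
- by move=> r t; exact: mixK.
- by move=> r t; have := @mixK R (qopp w) r t; rewrite qoppK qnorm2_opp; apply.
- by move=> r t r' t'; exact: mix_rdot.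
Qed.

Lemma swap_symmetry M : (forall x, M x -> M (swap m l x)) -> symmetry M (swap m l) (swap m l).
Proof. by move=> sM; apply: on_rows_symmetry => // r t r' t'; rewrite addrC. Qed.

Lemma lq_row_symmetry M w : qnorm2 w = 1 -> (forall x, M x -> M (lq_row m l w x)) ->
  (forall x, M x -> M (lq_row m l (qconj w) x)) ->
  symmetry M (lq_row m l w) (lq_row m l (qconj w)).
Proof.
move=> w1 wM wVM; apply: on_rows_symmetry => //.
- by move=> a r t r' t'; rewrite lq_linear.
- by move=> r t; split=> //; exact: (lqK r w1).1.
- by move=> r t; split=> //; exact: (lqK r w1).2.
- by move=> r t r' t'; rewrite rdot_lq w1 mul1r.
Qed.

Lemma sphere_mix w : qnorm2 w = 1 -> symmetry (sphere n) (mix m l w) (mix m l (qopp w)).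
Proof. by move=> w1; apply: (@symmetry_sphere _ _ setT); exact: mix_symmetry. Qed.

Lemma sphere_lq_row w : qnorm2 w = 1 ->
  symmetry (sphere n) (lq_row m l w) (lq_row m l (qconj w)).
Proof. by move=> w1; apply: (@symmetry_sphere _ _ setT); exact: lq_row_symmetry. Qed.

Lemma sphere_swap : symmetry (sphere n) (swap m l) (swap m l).
Proof. by apply: (@symmetry_sphere _ _ setT); exact: swap_symmetry. Qed.

(** Left multiplication by R + jR preserves both R + jR and iR + kR. Together with the restriction
    to complex w on the Stiefel manifold, only w = 1 and w = -1 survive. *)
Lemma planar_mix w : qnorm2 w = 1 -> qi w = 0 -> qk w = 0 ->
  symmetry planar (mix m l w) (mix m l (qopp w)).
Proof.
have h w' x : qi w' = 0 -> qk w' = 0 -> planar x -> planar (mix m l w' x).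
  move=> wi wk; apply: on_rows_planar => r t [r1 r3] [t1 t3]; rewrite /planar1 /planar2;
  by do 3 rewrite ?mxE /=; rewrite wi wk r1 r3 t1 t3; do !split; ring.
by move=> w1 wi wk; apply: mix_symmetry => // x; apply: h => //=; rewrite ?wi ?wk oppr0.
Qed.

Lemma planar_lq_row w : qnorm2 w = 1 -> qi w = 0 -> qk w = 0 ->
  symmetry planar (lq_row m l w) (lq_row m l (qconj w)).
Proof.
have h w' x : qi w' = 0 -> qk w' = 0 -> planar x -> planar (lq_row m l w' x).
  move=> wi wk; apply: on_rows_planar => r t [r1 r3] [t1 t3]; rewrite /planar1 /planar2;
  by do 3 rewrite ?mxE /=; rewrite ?wi ?wk r1 r3 t1 t3; do !split; ring.
by move=> w1 wi wk; apply: lq_row_symmetry => // x; apply: h => //=; rewrite ?wi ?wk oppr0.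
Qed.

Lemma planar_swap : symmetry planar (swap m l) (swap m l).
Proof. by apply: swap_symmetry => x; exact: on_rows_planar. Qed.

Lemma model_pol3_on_rows p q :
  (forall r t, [/\ formA (p r t) + formA (q r t) = formA r + formA t,
      formB (p r t) + formB (q r t) = formB r + formB t,
      formRe (p r t) + formRe (q r t) = formRe r + formRe t &
      formIm (p r t) + formIm (q r t) = formIm r + formIm t]) ->
  forall x, model_pol3 n x -> model_pol3 n (on_rows m l p q x).
Proof.
move=> pq x; have [h1 h2 h3 h4] := pq (row m x) (row l x).
rewrite !model_pol3_forms.
by rewrite (sum_on_rows1 ml h1) (sum_on_rows1 ml h2) (sum_on_rows1 ml h3) (sum_on_rows1 ml h4).
Qed.

Lemma model_pol3_mix w : qnorm2 w = 1 -> qj w = 0 -> qk w = 0 ->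
  symmetry (model_pol3 n) (mix m l w) (mix m l (qopp w)).
Proof.
move=> w1 wj wk; apply: mix_symmetry => // x; apply: model_pol3_on_rows => r t.
  exact: mix_forms.
by apply: mix_forms; rewrite ?qnorm2_opp//= ?wj ?wk oppr0.
Qed.

Lemma model_pol3_swap : symmetry (model_pol3 n) (swap m l) (swap m l).
Proof.
by apply: swap_symmetry => x; apply: model_pol3_on_rows => r t; split; rewrite addrC.
Qed.

End Pairs.

Lemma lq_rowwise_symmetry M w : qnorm2 w = 1 -> (forall x, M x -> M (rowwise (lq w) x)) ->
  (forall x, M x -> M (rowwise (lq (qconj w)) x)) ->
  symmetry M (rowwise (lq w)) (rowwise (lq (qconj w))).
Proof.
move=> w1 wM wVM; apply: rowwise_symmetry => //.
- exact: lq_linear.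
- by move=> r; exact: (lqK r w1).1.
- by move=> r; exact: (lqK r w1).2.
- by move=> r t; rewrite rdot_lq w1 mul1r.
Qed.

Lemma qnorm2_unit_i : qnorm2 (@unit_i R) = 1.
Proof. by rewrite /qnorm2 /=; ring. Qed.

Lemma qnorm2_unit_j : qnorm2 (@unit_j R) = 1.
Proof. by rewrite /qnorm2 /=; ring. Qed.

Lemma sphere_lq w : qnorm2 w = 1 ->
  symmetry (sphere n) (rowwise (lq w)) (rowwise (lq (qconj w))).
Proof. by move=> w1; apply: (@symmetry_sphere _ _ setT); exact: lq_rowwise_symmetry. Qed.

(** Left multiplication by i exchanges the two planes. *)
Lemma planar_lq_i : symmetry (planar : set V) (rowwise (lq unit_i)) (rowwise (lq (qconj unit_i))).
Proof.
apply: lq_rowwise_symmetry; first exact: qnorm2_unit_i.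
  move=> x; apply: rowwise_planar; right; rewrite /planar1 /planar2; split=> r [r1 r2];
  by do 3 rewrite ?mxE /=; rewrite r1 r2; split; ring.
move=> x; apply: rowwise_planar; right; rewrite /planar1 /planar2; split=> r [r1 r2];
by do 3 rewrite ?mxE /=; rewrite r1 r2; split; ring.
Qed.

Lemma planar_lq_j : symmetry (planar : set V) (rowwise (lq unit_j)) (rowwise (lq (qconj unit_j))).
Proof.
apply: lq_rowwise_symmetry; first exact: qnorm2_unit_j.
  move=> x; apply: rowwise_planar; left; rewrite /planar1 /planar2; split=> r [r1 r2];
  by do 3 rewrite ?mxE /=; rewrite r1 r2; split; ring.
move=> x; apply: rowwise_planar; left; rewrite /planar1 /planar2; split=> r [r1 r2];
by do 3 rewrite ?mxE /=; rewrite r1 r2; split; ring.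
Qed.

(** The pair ([formRe], [formIm]) is multiplied by the complex number u + iv, so its total stays
    0. *)
Lemma model_pol3_rowwise f (u v : R) :
  (forall r, formA (f r) = formA r) -> (forall r, formB (f r) = formB r) ->
  (forall r, formRe (f r) = u * formRe r - v * formIm r) ->
  (forall r, formIm (f r) = v * formRe r + u * formIm r) ->
  forall x, model_pol3 n x -> model_pol3 n (rowwise f x).
Proof.
move=> fA fB fr fi x; rewrite !model_pol3_forms => -[xA xB xr xi].
split.
- by under eq_bigr do rewrite row_rowwise fA.
- by under eq_bigr do rewrite row_rowwise fB.
- under eq_bigr do rewrite row_rowwise fr.
  by rewrite big_split/= sumrN -!mulr_sumr xr xi !mulr0 subrr.
- under eq_bigr do rewrite row_rowwise fi.
  by rewrite big_split/= -!mulr_sumr xr xi !mulr0 addr0.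
Qed.

Lemma model_pol3_lq_i :
  symmetry (model_pol3 n : set V) (rowwise (lq unit_i)) (rowwise (lq (qconj unit_i))).
Proof.
apply: lq_rowwise_symmetry; first exact: qnorm2_unit_i.
  move=> x; apply: (@model_pol3_rowwise _ 1 0) => r;
  by rewrite /formA /formB /formRe /formIm; do 3 rewrite ?mxE /=; ring.
move=> x; apply: (@model_pol3_rowwise _ 1 0) => r;
by rewrite /formA /formB /formRe /formIm; do 3 rewrite ?mxE /=; ring.
Qed.

Lemma phaseB_symmetry M : (forall x, M x -> M (rowwise phaseB x)) ->
  (forall x, M x -> M (rowwise phaseBV x)) ->
  symmetry M (rowwise phaseB) (rowwise phaseBV).
Proof.
move=> pM pVM; apply: rowwise_symmetry => //.
- by move=> a r t; apply: row4_ext; do 3 rewrite ?mxE /=; ring.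
- by move=> r; apply: row4_ext; do 3 rewrite ?mxE /=; ring.
- by move=> r; apply: row4_ext; do 3 rewrite ?mxE /=; ring.
- by move=> r t; rewrite /rdot; do 3 rewrite ?mxE /=; ring.
Qed.

Lemma model_pol3_phaseB : symmetry (model_pol3 n : set V) (rowwise phaseB) (rowwise phaseBV).
Proof.
apply: phaseB_symmetry => x.
  apply: (@model_pol3_rowwise _ 0 1) => r;
  by rewrite /formA /formB /formRe /formIm; do 3 rewrite ?mxE /=; ring.
apply: (@model_pol3_rowwise _ 0 (-1)) => r;
by rewrite /formA /formB /formRe /formIm; do 3 rewrite ?mxE /=; ring.
Qed.

(** The map b |-> ib leaves the planes, while its square b |-> -b preserves them. *)
Lemma planar_phaseB2 : symmetry (planar : set V) (iter 2 (rowwise phaseB)) (iter 2 (rowwise phaseBV)).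
Proof.
have [TL TK TVK Td _ _] := symmetry_iter 2 (@phaseB_symmetry setT (fun _ _ => I) (fun _ _ => I)).
split=> // x; rewrite !planarE => -[h|h]; [left|right|left|right] => s;
  by have := h s; rewrite /planar1 /planar2 !row_rowwise; do 3 rewrite ?mxE /=;
    case=> -> ->; rewrite ?oppr0.
Qed.

End ModelSymmetries.

(** * Dimensions and finite atlases of the four model spaces *)

Section Atlases.
Context {R : realType} {n : nat}.
Local Notation V := 'M[R]_(n, 4).
Implicit Types (x y : V) (s : 'I_n).
Local Notation rotI := (rowwise (lq (@unit_i R))).
Local Notation rotJ := (rowwise (lq (@unit_j R))).
Local Notation rotB := (rowwise (@phaseB R)).

Lemma card_all : #|{: 'I_n * 'I_4}| = (4 * n)%N.
Proof. by rewrite card_prod !card_ord mulnC. Qed.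

Let evens : {set 'I_n * 'I_4} := [set i | (i.2 == 0) || (i.2 == 2)].

Lemma card_evens : #|evens| = (2 * n)%N.
Proof.
have -> : evens = finset.setX [set: 'I_n] [set 0; 2].
  by apply/setP => -[s c]; rewrite !inE.
by rewrite cardsX cardsT card_ord cards2 mulnC.
Qed.

Lemma card_arm3 s0 : #|~: [set (s0, 0 : 'I_4)]| = (4 * n - 1)%N.
Proof. by rewrite cardsC1 card_all subn1. Qed.

Lemma card_arm2 s0 : #|~: [set (s0, 0 : 'I_4)] :&: evens| = (2 * n - 1)%N.
Proof.
have -> : ~: [set (s0, 0 : 'I_4)] :&: evens = evens :\ (s0, 0).
  by apply/setP => i; rewrite !inE.
by have := cardsD1 (s0, 0 : 'I_4) evens; rewrite card_evens inE /= add1n => ->; rewrite subn1.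
Qed.

Lemma card_pol3 s0 s1 : s0 != s1 -> #|pivot_slice s0 s1| = (4 * n - 4)%N.
Proof.
move=> s01.
have h : #|[set (s0, 0 : 'I_4); (s0, 2); (s0, 3); (s1, 2)]%SET| = 4.
  rewrite -!finset.setUA !cardsU1 cards1 !inE !xpair_eqE !eqxx /= (negPf s01) /=.
  by [].
by rewrite cardsCs finset.setCK h card_all.
Qed.

(** Of the four entries fixed by [pivot_slice], (s0, 3) is odd and already absent; three are taken
    from the 2n even ones. *)
Lemma card_pol2 s0 s1 : s0 != s1 -> #|pivot_slice s0 s1 :&: evens| = (2 * n - 3)%N.
Proof.
move=> s01.
have h : #|[set (s0, 0 : 'I_4); (s0, 2); (s1, 2)]%SET| = 3.
  rewrite -!finset.setUA !cardsU1 cards1 !inE !xpair_eqE !eqxx /= (negPf s01) /=.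
  by [].
have -> : pivot_slice s0 s1 :&: evens = evens :\: [set (s0, 0 : 'I_4); (s0, 2); (s1, 2)].
  apply/setP => -[s c]; rewrite !inE /= !xpair_eqE.
  by elim/ord4P: c; rewrite /= ?andbF ?andbT ?orbF.
rewrite cardsD card_evens (_ : evens :&: _ = [set (s0, 0 : 'I_4); (s0, 2); (s1, 2)]%SET) ?h//.
apply/finset.setIidPr; apply/fintype.subsetP => -[s c]; rewrite !inE !xpair_eqE.
by elim/ord4P: c; rewrite /= ?andbF ?andbT ?orbF.
Qed.

Lemma rotIE x s : ((rotI x s 0 = - x s 1) * (rotI x s 1 = x s 0)) *
  ((rotI x s 2 = - x s 3) * (rotI x s 3 = x s 2)).
Proof. by do !split; do 4 rewrite ?mxE /=; ring. Qed.

Lemma rotJE x s : (rotJ x s 0 = - x s 2) * (rotJ x s 2 = x s 0).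
Proof. by do !split; do 4 rewrite ?mxE /=; ring. Qed.

Lemma rotBE x s : ((rotB x s 0 = x s 0) * (rotB x s 1 = x s 1)) *
  ((rotB x s 2 = - x s 3) * (rotB x s 3 = x s 2)).
Proof. by do !split; do 4 rewrite ?mxE /=. Qed.

(** Powers of i turn a complex number by quarter turns, and one of the four turns of a nonzero
    number has positive real part. *)
Lemma rotI_pos x s : (x s 0 != 0) || (x s 1 != 0) -> exists k : 'I_4, 0 < iter k rotI x s 0.
Proof.
case: (ltrgtP (x s 0) 0) => [x0 _|x0 _|_ /=].
- by exists 2; rewrite /= !rotIE oppr_gt0.
- by exists 0.
case: (ltrgtP (x s 1) 0) => // x1 _.
- by exists 1; rewrite /= !rotIE oppr_gt0.
- by exists 3; rewrite /= !rotIE opprK.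
Qed.

(** If the first half of the row vanishes, j brings coordinate 2 to position 0, after one turn by i
    when only coordinate 3 is nonzero; the power of j fixes the sign. *)
Lemma sphere_cover x : sphere n x ->
  exists s (k l : 'I_4), 0 < iter l rotJ (iter k rotI x) s 0.
Proof.
rewrite sphereE /= => xN.
have [s xs] : exists s, (x s 0 != 0) || (x s 1 != 0) || (x s 2 != 0) || (x s 3 != 0).
  apply/not_existsP => x0; have : (2 : R) != 0 by rewrite pnatr_eq0.
  rewrite -xN /sqnA /sqnB !big1 ?addr0 ?eqxx// => s _; have /negP := x0 s;
    by rewrite !negb_or !negbK => /andP[/andP[/andP[/eqP y0 /eqP y1] /eqP y2] /eqP y3];
    rewrite ?y0 ?y1 ?y2 ?y3 expr0n addr0.
exists s; move: xs; rewrite -orbA => /orP[/rotI_pos[k ?]|]; first by exists k, 0.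
case: (ltrgtP (x s 2) 0) => [x2 _|x2 _|_ /=].
- by exists 0, 1; rewrite /= !rotJE oppr_gt0.
- by exists 0, 3; rewrite /= !rotJE opprK.
case: (ltrgtP (x s 3) 0) => // x3 _.
- by exists 1, 3; rewrite /= !rotJE opprK !rotIE oppr_gt0.
- by exists 1, 1; rewrite /= !rotJE !rotIE opprK.
Qed.

Lemma finite_atlas_arm3 : finite_atlas (m := (4 * n - 1)%N) (model_arm3 n : set V).
Proof.
apply: (@finite_atlas_translate _ _ _ _ _ _ _ _ _ 'I_n (fun s => [set x | 0 < x s 0]) 4 4
  (sphere_lq qnorm2_unit_i) (sphere_lq qnorm2_unit_j)) => [s|x /sphere_cover[s [k [l h]]]].
  by apply: open_pos; exact: coord_continuous.
exists s, k, l; split=> //.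
by have := retraction_charted (@sphere_retraction R n s); rewrite card_arm3.
Qed.

Lemma finite_atlas_arm2 : finite_atlas (m := (2 * n - 1)%N) (model_arm2 n : set V).
Proof.
rewrite model_arm2E.
apply: (@finite_atlas_translate _ _ _ _ _ _ _ _ _ 'I_n (fun s => [set x | 0 < x s 0]) 4 4
  (symmetry_setI (sphere_lq qnorm2_unit_i) planar_lq_i)
  (symmetry_setI (sphere_lq qnorm2_unit_j) planar_lq_j)).
  by move=> s; apply: open_pos; exact: coord_continuous.
move=> x [/sphere_cover[s [k [l h]]] _]; exists s, k, l; split=> //.
have := retraction_charted (retraction_planar (@sphere_retraction R n s) _ _ _ _).
rewrite -/evens card_arm2; apply.
- by move=> y yL t; have [y1 y3] := yL t; rewrite !mxE y1 y3 !mulr0.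
- by move=> y yL t; have [y1 y3] := yL t; rewrite !mxE y1 y3 !mulr0.
- by move=> t; rewrite !mxE !andbF.
- by move=> y /= [y0 [//|/(_ s)[ys]]]; rewrite ys ltxx in y0.
Qed.

Lemma sqnB_triang1 t r r' x : sqnB (triang 1 t r r' x) =
  t ^+ 2 * sqnB x + (r ^+ 2 + r' ^+ 2) * sqnA x + 2 * t * (r * hermRe x + r' * hermIm x).
Proof.
rewrite /sqnB /sqnA /hermRe /hermIm [2 * t * _]mulrDr !mulr_sumr -!big_split.
by apply: eq_bigr => s _ /=; rewrite !mx4E; ring.
Qed.

(** With c = |a_s0|^2 and z = b_s0 conj(a_s0), orthonormality gives |c b - z a|^2 = c^2 + |z|^2 > 0.
    The entry at s0 is 0, so a nonzero one sits in another row. *)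
Lemma row_resid_neq0 x s0 : model_pol3 n x -> x s0 0 != 0 ->
  exists s1, s0 != s1 /\ (row_resid s0 x s1 2 != 0) || (row_resid s0 x s1 3 != 0).
Proof.
rewrite model_pol3E => -[xA xB xr xi] x0.
have [s1 h1] : exists s1, (row_resid s0 x s1 2 != 0) || (row_resid s0 x s1 3 != 0).
  apply/not_existsP => h.
  have : sqnB (row_resid s0 x) = 0.
    apply: big1 => s _; have /negP := h s; rewrite !negb_or !negbK => /andP[/eqP-> /eqP->].
    by rewrite expr0n addr0.
  apply/eqP; rewrite gt_eqF// /row_resid sqnB_triang1 xA xB xr xi !mulr0 !addr0 !mulr1.
  have A0 : 0 < x s0 0 ^+ 2 + x s0 1 ^+ 2.
    by apply: ltr_wpDr; [exact: sqr_ge0|rewrite exprn_even_gt0].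
  rewrite mulr0 addr0; apply: ltr_wpDr; last by rewrite exprn_gt0.
  by rewrite addr_ge0 ?sqr_ge0.
exists s1; split=> //; apply/eqP => e; move: h1; rewrite -e.
have -> : row_resid s0 x s0 2 = 0 by rewrite mx4E; ring.
have -> : row_resid s0 x s0 3 = 0 by rewrite mx4E; ring.
by rewrite eqxx.
Qed.

Lemma row_resid_rotB s0 x s : row_resid s0 (rotB x) s 2 = - row_resid s0 x s 3 /\
  row_resid s0 (rotB x) s 3 = row_resid s0 x s 2.
Proof. by rewrite !mx4E !rotBE; split; ring. Qed.

Lemma model_pol3_rotI_pos x : model_pol3 n x -> exists s (k : 'I_4), 0 < iter k rotI x s 0.
Proof.
rewrite model_pol3E => -[xA _ _ _].
have [s xs] : exists s, (x s 0 != 0) || (x s 1 != 0).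
  apply/not_existsP => h; have : (1 : R) != 0 by rewrite oner_eq0.
  rewrite -xA /sqnA big1 ?eqxx// => s _; have /negP := h s.
  by rewrite negb_or !negbK => /andP[/eqP-> /eqP->]; rewrite expr0n addr0.
by exists s; exact: rotI_pos.
Qed.

Lemma pivot_dom_open s0 s1 : open (pivot_dom s0 s1 : set V).
Proof.
apply: openI; first by apply: open_pos; exact: coord_continuous.
by apply: open_pos => x; exact: differentiable_continuous (row_resid_differentiable _ _ _ _).
Qed.

Lemma finite_atlas_pol3 : finite_atlas (m := (4 * n - 4)%N) (model_pol3 n : set V).
Proof.
apply: (@finite_atlas_translate _ _ _ _ _ _ _ _ _ ('I_n * 'I_n)%type
  (fun i => pivot_dom i.1 i.2) 4 4 model_pol3_lq_i model_pol3_phaseB).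
  by move=> i; exact: pivot_dom_open.
move=> x xM; have [s0 [k xk]] := model_pol3_rotI_pos xM.
have yM : model_pol3 n (iter k rotI x).
  exact: sym_sub (symmetry_iter k model_pol3_lq_i) _ xM.
have [s1 [s01 h1]] := row_resid_neq0 yM (lt0r_neq0 xk).
have ch : charted (m := (4 * n - 4)%N) (model_pol3 n) (pivot_dom s0 s1 : set V).
  by have := retraction_charted (@stiefel_retraction R n s0 s1 s01); rewrite card_pol3.
exists (s0, s1), k; suff [l hl] : exists l : 'I_4, pivot_dom s0 s1 (iter l rotB (iter k rotI x)).
  by exists l.
move: {yM xM} (iter k rotI x) xk h1 => y y0.
(* Changing the phase of b leaves a alone, so the positivity already gained at s0 persists. *)
have y0l l : 0 < iter l rotB y s0 0 by elim: l => //= l; rewrite rotBE.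
case: (ltrgtP (row_resid s0 y s1 2) 0) => [h _|h _|_ /=].
- exists 2; split; first exact: y0l.
  by rewrite /= (row_resid_rotB _ _ _).1 (row_resid_rotB _ _ _).2 oppr_gt0.
- by exists 0.
case: (ltrgtP (row_resid s0 y s1 3) 0) => // h _.
- by exists 1; split; [exact: y0l|rewrite /= (row_resid_rotB _ _ _).1 oppr_gt0].
- exists 3; split; first exact: y0l.
  by rewrite /= (row_resid_rotB _ _ _).1 (row_resid_rotB _ _ _).2 (row_resid_rotB _ _ _).1 opprK.
Qed.

Lemma planar1_pos x s : planar x -> 0 < x s 0 -> forall t, x t 1 = 0 /\ x t 3 = 0.
Proof. by move=> [//|/(_ s)[xs]]; rewrite xs ltxx. Qed.

Lemma row_resid_planar x s0 s : (forall t, x t 1 = 0 /\ x t 3 = 0) -> row_resid s0 x s 3 = 0.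
Proof.
by move=> xL; rewrite mx4E; have [-> ->] := xL s; have [-> ->] := xL s0; ring.
Qed.

Lemma triang_planar p t r x : (forall s, x s 1 = 0 /\ x s 3 = 0) ->
  forall s, triang p t r 0 x s 1 = 0 /\ triang p t r 0 x s 3 = 0.
Proof.
by move=> xL s; rewrite !mx4E; have [-> ->] := xL s; rewrite !mulr0 mul0r !addr0.
Qed.

Lemma finite_atlas_pol2 : finite_atlas (m := (2 * n - 3)%N) (model_pol2 n : set V).
Proof.
rewrite model_pol2E.
have sI := symmetry_setI (@model_pol3_lq_i R n) (@planar_lq_i R n).
have sB := symmetry_setI (symmetry_iter 2 (@model_pol3_phaseB R n)) (@planar_phaseB2 R n).
apply: (@finite_atlas_translate _ _ _ _ _ _ _ _ _ ('I_n * 'I_n)%type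
  (fun i => pivot_dom i.1 i.2) 4 2 sI sB).
  by move=> i; exact: pivot_dom_open.
move=> x xM; have [s0 [k xk]] := model_pol3_rotI_pos xM.1.
have [yM yP] : (model_pol3 n `&` planar) (iter k rotI x).
  exact: sym_sub (symmetry_iter k sI) _ xM.
have [s1 [s01 h1]] := row_resid_neq0 yM (lt0r_neq0 xk).
have yL := planar1_pos yP xk.
(* On the real plane the residual is real: only its sign has to be corrected, and b |-> -b does
   so. *)
rewrite (row_resid_planar _ _ yL) eqxx orbF in h1.
exists (s0, s1), k.
suff [l hl] : exists l : 'I_2, pivot_dom s0 s1 (iter l (iter 2 rotB) (iter k rotI x)).
  exists l; split=> //.
  have := retraction_charted (retraction_planar (@stiefel_retraction R n s0 s1 s01) _ _ _ _).
  rewrite -/evens card_pol2//; apply.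
  - move=> z zL; rewrite /gram_schmidt /gs_resid.
    have -> : hermIm z = 0.
      by apply: big1 => t _; have [-> ->] := zL t; rewrite mul0r mulr0 subrr.
    by rewrite oppr0; do 2 apply: triang_planar.
  - move=> z zL; rewrite /pivot_normalize /row_resid.
    have [z1 z3] := zL s0; rewrite z1 z3 !mulr0 mul0r subrr oppr0.
    by do 2 apply: triang_planar.
  - by move=> t; rewrite !mxE !andbF addr0.
  - by move=> z [[z0 _] zP]; exact: planar1_pos zP z0.
move: {yM yP yL xM} (iter k rotI x) xk h1 => y y0.
case: (ltrgtP (row_resid s0 y s1 2) 0) => // h _.
- exists 1; split; rewrite /= ?rotBE//.
  by rewrite (row_resid_rotB _ _ _).1 (row_resid_rotB _ _ _).2 oppr_gt0.
- by exists 0.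
Qed.

End Atlases.

(** * Averages and moments *)

Section Means.
Context {R : realType} {n : nat}.
Local Notation V := 'M[R]_(n, 4).

(* E f stands for the average of f over M; it is only meaningful for f satisfying good. *)
Record mean (M : set V) (good : (V -> R) -> Prop) (E : (V -> R) -> R) : Prop := Mean {
  good_cst : forall a, good (fun=> a);
  good_entry : forall s c, good (fun x => x s c);
  goodD : forall f g, good f -> good g -> good (fun x => f x + g x);
  goodM : forall f g, good f -> good g -> good (fun x => f x * g x);
  meanD : forall f g, good f -> good g -> E (fun x => f x + g x) = E f + E g;
  meanZ : forall a f, good f -> E (fun x => a * f x) = a * E f;
  mean_cst : forall a, E (fun=> a) = a;
  mean_eq : forall f g, (forall x, M x -> f x = g x) -> E f = E g;
  mean_sym : forall T S f, symmetry M T S -> good f -> E (f \o T) = E f }.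

Section Construction.
Variables (m d : nat) (M : set V) (h : V -> 'M[R]_(n, d)).
Variable P : probability (borel 'M[R]_(n, d)) R.
Variable vol : {measure set (borel V) -> \bar R}.
Hypotheses (volM : riemannian_volume m M vol)
  (PE : forall A, measurable A ->
    P A = ((fine (vol M))^-1%:E * pushforward vol (h : borel _ -> borel _) A)%E)
  (mM : measurable (M : set (borel V))) (atl : finite_atlas (m := m) M)
  (bM : forall x, M x -> forall s c, `|x s c| <= 2) (ch : continuous h).

(** Measurable functions bounded on M: a class closed under products and integrable because M has
    finite volume. *)
Let good (f : V -> R) : Prop :=
  measurable_fun setT (f : borel V -> R) /\ exists K, forall x, M x -> `|f x| <= K.

Let E (f : V -> R) : R := (fine (vol M))^-1 * (\int[vol]_(x in (M : set (borel V))) f x).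

Lemma volT : vol setT = vol M.
Proof.
have [vM0 _] := volM; rewrite -(setUv M) measureU ?setICr//.
  by rewrite [X in (_ + X)%E]vM0 adde0.
exact: measurableC.
Qed.

(** Were the volume 0 or infinite, [fine] would return 0, whose inverse is 0 by convention, and P
    would have mass 0 instead of 1. *)
Lemma vol_fin : (vol M < +oo)%E /\ fine (vol M) != 0.
Proof.
have := PE measurableT; rewrite probability_setT /pushforward preimage_setT volT => h1.
split.
  rewrite ltey; apply/eqP => e; move: h1; rewrite e /= invr0 mul0e => /eqP.
  by rewrite onee_eq0.
apply/eqP => e; move: h1; rewrite e invr0 mul0e => /eqP.
by rewrite onee_eq0.
Qed.

Lemma good_integrable f : good f -> vol.-integrable (M : set (borel V)) (EFin \o f).
Proof.
move=> [mf [K fK]]; have [volfin _] := vol_fin.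
apply: measurable_bounded_integrable => //; first exact: measurable_funTS.
exists K; split; first exact: num_real.
by move=> y Ky x Mx /=; apply: le_trans (ltW Ky); exact: fK.
Qed.

Lemma mean_volume : mean M good E.
Proof.
have [volfin vol0] := vol_fin.
split.
- move=> a; split; first exact: measurable_cst.
  by exists `|a|.
- move=> s c; split; last by exists 2 => x Mx; exact: bM.
  by apply: continuous_borel_measurable_real; exact: coord_continuous.
- move=> f g [mf [K fK]] [mg [L gL]]; split; first exact: measurable_funD.
  by exists (K + L) => x Mx; apply: le_trans (ler_normD _ _) _; rewrite lerD ?fK ?gL.
- move=> f g [mf [K fK]] [mg [L gL]]; split; first exact: measurable_funM.
  by exists (K * L) => x Mx; rewrite normrM ler_pM ?fK ?gL.
- move=> f g gf gg; rewrite /E RintegralD ?mulrDr//; exact: good_integrable.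
- move=> a f gf; rewrite /E [RHS]mulrCA; congr (_ * _).
  exact: (RintegralZl (T := borel V) a mM (good_integrable gf)).
- by move=> a; rewrite /E Rintegral_cst// mulrCA mulVf ?mulr1.
- by move=> f g fg; rewrite /E; congr (_ * _); apply: eq_Rintegral => x; rewrite inE; exact: fg.
- move=> T S f sT gf; have [mf [K fK]] := gf.
  have mT : measurable_fun setT (T : borel V -> borel V).
    exact: continuous_borel_measurable (symmetry_continuous sT).
  rewrite /E; congr (_ * fine _).
  have TM : T @^-1` M = M.
    by rewrite -(symmetry_image _ (symmetryV sT)) (symmetry_imageM (symmetryV sT)).
  have gfT : vol.-integrable (M : set (borel V)) (EFin \o (f \o T)).
    apply: good_integrable; split; first exact: measurableT_comp mf mT.
    by exists K => x Mx; apply: fK; exact: (sym_sub sT).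
  (* Integrating [f \o T] amounts to integrating f against the pushforward of [vol] by T, which
     agrees with [vol] on measurable sets. *)
  have := @integral_pushforward _ _ (borel V) (borel V) R T mT vol M (EFin \o f) _ _ mM.
  rewrite TM => <-//; last by apply/measurable_EFinP.
  apply: eq_measure_integral => A mA _.
  exact: (riemannian_volume_symmetry sT atl mM volM mA).
Qed.

Lemma integral_pushforward_mean (D : set (borel 'M[R]_(n, d))) (f : 'M[R]_(n, d) -> R) :
  measurable D -> measurable_fun setT (f : borel 'M[R]_(n, d) -> R) ->
  (forall e, 0 <= f e) -> (forall x, M x -> D (h x)) -> good (f \o h) ->
  (\int[P]_(e in D) (f e)%:E = (E (f \o h))%:E)%E.
Proof.
move=> mD mf f0 hD gfh.
have [volfin vol0] := vol_fin.
have mh : measurable_fun setT (h : borel V -> borel 'M[R]_(n, d)).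
  exact: continuous_borel_measurable.
have c0 : 0 <= (fine (vol M))^-1 by rewrite invr_ge0 fine_ge0.
pose push : {measure set (borel 'M[R]_(n, d)) -> \bar R} :=
  pushforward vol (h : borel V -> borel 'M[R]_(n, d)).
pose nu := mscale (NngNum c0) (push mh).
rewrite (eq_measure_integral nu) => [|A mA _]; last exact: PE.
rewrite ge0_integral_mscale//=; last 2 first.
- by apply/measurable_EFinP; exact: measurable_funTS.
- by move=> x _; rewrite lee_fin.
rewrite ge0_integral_pushforward//; last 2 first.
- by apply/measurable_EFinP; exact: measurable_funTS.
- by move=> x _; rewrite lee_fin.
rewrite /E EFinM; congr (_ * _)%E.
have mhD : measurable (h @^-1` D : set (borel V)).
  by have := mh measurableT _ mD; rewrite setTI.
(* The preimage of D contains M and exceeds it only by a null set, so the integral is one over M. *)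
rewrite (@ge0_negligible_integral _ (borel V) R vol _ (~` M))//.
- have -> : h @^-1` D `\` ~` M = M.
    by rewrite setDE setCK; apply/setIidPr => x /hD.
  by rewrite /Rintegral fineK//; apply: integrable_fin_num => //; exact: good_integrable.
- exact: measurableC.
- by apply/measurable_EFinP; apply: measurable_funTS; exact: measurableT_comp mf mh.
- by move=> x _; rewrite lee_fin.
- by case: volM.
Qed.

End Construction.

(** Hides the volume measure: what follows relies only on the rules of [mean] and on this transfer
    of integrals. *)
Lemma mean_normalized_pushforward (m d : nat) (M : set V) (h : V -> 'M[R]_(n, d))
    (P : probability (borel 'M[R]_(n, d)) R) :
  normalized_pushforward m M h P -> measurable (M : set (borel V)) ->
  finite_atlas (m := m) M -> (forall x, M x -> forall s c, `|x s c| <= 2) -> continuous h ->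
  exists good E, mean M good E /\
    forall (D : set (borel 'M[R]_(n, d))) (f : 'M[R]_(n, d) -> R),
    measurable D -> measurable_fun setT (f : borel 'M[R]_(n, d) -> R) ->
    (forall e, 0 <= f e) -> (forall x, M x -> D (h x)) -> good (f \o h) ->
    (\int[P]_(e in D) (f e)%:E = (E (f \o h))%:E)%E.
Proof.
move=> [vol volM PE] mM atl bM ch.
eexists; eexists; split; first exact: mean_volume volM PE mM atl bM.
by move=> D f; exact: integral_pushforward_mean volM PE mM ch D f.
Qed.

End Means.

Section RowMoments.
Context {R : realType}.
Implicit Types (r t : 'rV[R]_4) (w : quaternion R).

Definition unit_1 : quaternion R := Quat 1 0 0 0.
Definition unit_k : quaternion R := Quat 0 0 0 1.

(** With S = |r|^2 + |t|^2 and D = <r, wt>, the new squared norms are S/2 + D and S/2 - D, whose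
    squares add up to S^2/2 + 2 D^2. *)
Lemma mix_norms w r t : qnorm2 w = 1 ->
  rdot (mixl w r t) (mixl w r t) ^+ 2 + rdot (mixr w r t) (mixr w r t) ^+ 2 =
  2^-1 * (rdot r r ^+ 2 + rdot t t ^+ 2) + rdot r r * rdot t t + 2 * rdot r (lq w t) ^+ 2.
Proof.
move=> w1.
have -> : rdot (mixl w r t) (mixl w r t) =
    (Num.sqrt 2)^-1 ^+ 2 * (rdot r r + qnorm2 w * rdot t t + 2 * rdot r (lq w t)).
  by rewrite /rdot /qnorm2; do 3 rewrite ?mxE /=; ring.
have -> : rdot (mixr w r t) (mixr w r t) =
    (Num.sqrt 2)^-1 ^+ 2 * (rdot t t + qnorm2 w * rdot r r - 2 * rdot r (lq w t)).
  by rewrite /rdot /qnorm2; do 3 rewrite ?mxE /=; ring.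
by rewrite w1 invsqrt2_sqr; field.
Qed.

(** Parseval: t, it, jt, kt are mutually orthogonal and all of length |t|. In a plane preserved by
    j, t and jt play this role. *)
Lemma sum_rdot_lq r t :
  rdot r (lq unit_1 t) ^+ 2 + rdot r (lq unit_i t) ^+ 2 + rdot r (lq unit_j t) ^+ 2
    + rdot r (lq unit_k t) ^+ 2 = rdot r r * rdot t t.
Proof. by rewrite /rdot; do 3 rewrite ?mxE /=; ring. Qed.

Lemma sum_rdot_lq_planar r t : planar1 r /\ planar1 t \/ planar2 r /\ planar2 t ->
  rdot r (lq unit_1 t) ^+ 2 + rdot r (lq unit_j t) ^+ 2 = rdot r r * rdot t t.
Proof.
by case=> -[[r0 r1] [t0 t1]]; rewrite /rdot; do 3 rewrite ?mxE /=; rewrite r0 r1 t0 t1; ring.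
Qed.

Lemma rdot_lq_i_planar r t : planar1 r /\ planar1 t \/ planar2 r /\ planar2 t ->
  rdot r (lq unit_i t) = 0.
Proof.
by case=> -[[r0 r1] [t0 t1]]; rewrite /rdot; do 3 rewrite ?mxE /=; rewrite r0 r1 t0 t1; ring.
Qed.

(** For rows (a, b) and (a', b'), both sides equal |a conj(a') + b conj(b')|^2; the two inner
    products are, up to sign, the real and imaginary parts. *)
Lemma herm_sqr r t : rdot r (lq unit_1 t) ^+ 2 + rdot r (lq unit_i t) ^+ 2 =
  formA r * formA t + formB r * formB t + 2 * (formRe r * formRe t + formIm r * formIm t).
Proof.
by rewrite /rdot /formA /formB /formRe /formIm; do 3 rewrite ?mxE /=; ring.
Qed.

Lemma rdot_form r : rdot r r = formA r + formB r.
Proof. by rewrite /rdot /formA /formB; ring. Qed.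

Lemma rdot_lq_1 r t : rdot r (lq unit_1 t) = rdot r t.
Proof. by rewrite /rdot; do 3 rewrite ?mxE /=; ring. Qed.

Lemma rdot_lq_i r : rdot r (lq unit_i r) = 0.
Proof. by rewrite /rdot; do 3 rewrite ?mxE /=; ring. Qed.

End RowMoments.

(** * Fourth moments from symmetry *)

Section Moments.
Context {R : realType} {n : nat}.
Local Notation V := 'M[R]_(n, 4).
Variables (M : set V) (good : (V -> R) -> Prop) (E : (V -> R) -> R).
Hypothesis H : mean M good E.
Implicit Types (f g : V -> R) (m l s : 'I_n).

Lemma goodN f : good f -> good (fun x => - f x).
Proof.
move=> gf; have -> : (fun x => - f x) = (fun x => -1 * f x) by apply/funext => x; rewrite mulN1r.
by apply: (goodM H) => //; exact: good_cst H _.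
Qed.

Lemma goodX2 f : good f -> good (fun x => f x ^+ 2).
Proof. by move=> gf; exact: (goodM H gf gf). Qed.

Lemma good_sum (I : Type) (r : seq I) (Q : pred I) (f : I -> V -> R) :
  (forall i, good (f i)) -> good (fun x => \sum_(i <- r | Q i) f i x).
Proof.
move=> gf; elim: r => [|i r IH].
  by under eq_fun do rewrite big_nil; exact: good_cst H _.
under eq_fun do rewrite big_cons; case: (Q i) => //; exact: (goodD H (gf i) IH).
Qed.

Lemma mean_sum (I : Type) (r : seq I) (Q : pred I) (f : I -> V -> R) :
  (forall i, good (f i)) -> E (fun x => \sum_(i <- r | Q i) f i x) = \sum_(i <- r | Q i) E (f i).
Proof.
move=> gf; elim: r => [|i r IH].
  by under eq_fun do rewrite big_nil; rewrite (mean_cst H) big_nil.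
under eq_fun do rewrite big_cons; rewrite big_cons; case: (Q i) => //.
by rewrite (meanD H) ?IH//; exact: good_sum.
Qed.

Lemma meanN f : good f -> E (fun x => - f x) = - E f.
Proof.
move=> gf; rewrite -mulN1r -(meanZ H)//; congr E; apply/funext => x; rewrite mulN1r.
by [].
Qed.

Local Ltac good_tac := repeat lazymatch goal with
  | |- good (fun _ => ?a) => exact: (good_cst H a)
  | |- good (fun x => @?f x + @?g x) => apply: (@goodD _ _ _ _ _ H f g)
  | |- good (fun x => @?f x * @?g x) => apply: (@goodM _ _ _ _ _ H f g)
  | |- good (fun x => - @?f x) => apply: (@goodN f)
  | |- good (fun x => @?f x ^+ 2) => apply: (@goodX2 f)
  | |- good (fun x => fun_of_matrix x _ _) => exact: (good_entry H)
  end.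

Definition qn s (x : V) : R := rdot (row s x) (row s x).
Definition qdot m l w (x : V) : R := rdot (row m x) (lq w (row l x)).

Lemma good_row_dot (p q : V -> 'rV[R]_4) : (forall c, good (fun x => p x 0 c)) ->
  (forall c, good (fun x => q x 0 c)) -> good (fun x => rdot (p x) (q x)).
Proof. by move=> gp gq; rewrite /rdot; good_tac; [exact: gp|exact: gq|exact: gp|exact: gq|exact: gp|exact: gq|exact: gp|exact: gq]. Qed.

Lemma good_row s c : good (fun x => row s x 0 c).
Proof. by under eq_fun do rewrite mxE; exact: good_entry H _ _. Qed.

Lemma good_qn s : good (qn s).
Proof. by apply: good_row_dot => c; exact: good_row. Qed.

Lemma good_qdot m l w : good (qdot m l w).
Proof.
apply: good_row_dot => c; first exact: good_row.
by elim/ord4P: c; under eq_fun do do 3 rewrite ?mxE /=; good_tac.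
Qed.

Let good_qn2 s : good (fun x => qn s x ^+ 2) := goodX2 (good_qn s).
Let good_qnqn m l : good (fun x => qn m x * qn l x) := goodM H (good_qn m) (good_qn l).
Let good_qdot2 m l w : good (fun x => qdot m l w x ^+ 2) := goodX2 (good_qdot m l w).

Hypothesis Mswap : forall m l, m != l -> symmetry M (swap m l) (swap m l).
Hypothesis Msum : forall x, M x -> \sum_s qn s x = 2.

Variable s0 : 'I_n.
Let X := E (fun x => qn s0 x ^+ 2).

Lemma mean_qn_eq m : E (qn m) = E (qn s0).
Proof.
have [->//|ms] := eqVneq m s0.
rewrite -(mean_sym H (Mswap ms) (good_qn m)); congr E.
by apply/funext => x; rewrite /qn /= row_on_rows eqxx.
Qed.

Lemma mean_qn2_eq m : E (fun x => qn m x ^+ 2) = X.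
Proof.
have [->//|ms] := eqVneq m s0.
rewrite -(mean_sym H (Mswap ms) (good_qn2 m)); congr E.
by apply/funext => x; rewrite /qn /= row_on_rows eqxx.
Qed.

Lemma n_neq0 : n%:R != 0 :> R.
Proof. by rewrite pnatr_eq0; case: n s0 => // -[]. Qed.

Lemma mean_qn : E (qn s0) = 2 / n%:R.
Proof.
have : E (fun x => \sum_s qn s x) = 2 by rewrite -(mean_cst H 2); apply: (mean_eq H) => x /Msum.
rewrite mean_sum; last exact: good_qn.
under eq_bigr do rewrite mean_qn_eq.
rewrite sumr_const card_ord -[_ *+ n]mulr_natr => h.
by apply: (mulIf n_neq0); rewrite h mulfVK// n_neq0.
Qed.

Lemma mean_qn_total : X + \sum_(l | l != s0) E (fun x => qn s0 x * qn l x) = 4 / n%:R.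
Proof.
have e : E (fun x => \sum_l qn s0 x * qn l x) = 4 / n%:R.
  have -> : 4 / n%:R = 2 * (2 / n%:R) :> R by rewrite mulrA -natrM.
  rewrite -mean_qn -(meanZ H); last exact: good_qn.
  by apply: (mean_eq H) => x Mx; rewrite -mulr_sumr Msum// mulrC.
rewrite mean_sum in e; last by move=> l; exact: good_qnqn.
by rewrite -e [RHS](bigD1 s0).
Qed.

Lemma mean_mix m l w : m != l -> qnorm2 w = 1 -> symmetry M (mix m l w) (mix m l (qopp w)) ->
  X = E (fun x => qn m x * qn l x) + 2 * E (fun x => qdot m l w x ^+ 2).
Proof.
move=> ml w1 sT.
have lm : (l == m) = false by rewrite eq_sym (negPf ml).
have gmix := goodD H (good_qn2 m) (good_qn2 l).
have e : E (fun x => qn m x ^+ 2 + qn l x ^+ 2) = X + X.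
  by rewrite (meanD H) ?mean_qn2_eq.
have := mean_sym H sT gmix; rewrite e.
have -> : (fun x => qn m x ^+ 2 + qn l x ^+ 2) \o mix m l w =
    (fun x => 2^-1 * (qn m x ^+ 2 + qn l x ^+ 2) + (qn m x * qn l x + 2 * qdot m l w x ^+ 2)).
  apply/funext => x; rewrite /qn /qdot /= !row_on_rows !eqxx lm mix_norms//.
  by rewrite addrA.
have g2 : good (fun x => 2 * qdot m l w x ^+ 2).
  exact: (goodM H (good_cst H 2) (good_qdot2 m l w)).
rewrite (meanD H); [|exact: (goodM H (good_cst H _) gmix)|exact: (goodD H (good_qnqn m l) g2)].
rewrite (meanZ H)// e (meanD H)// (meanZ H)//.
(* Averaging [mix_norms] has given 2X = X + Y + 2C. *)
set Y := E _; set C := E _ => h; lra.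
Qed.

Lemma mean_qn_total_scaled (a : R) :
  (forall l, l != s0 -> E (fun x => qn s0 x * qn l x) = a * X) ->
  X * (1 + (n%:R - 1) * a) = 4 / n%:R.
Proof.
move=> h; rewrite -mean_qn_total (eq_bigr (fun=> a * X)) => [|l]; last exact: h.
rewrite sumr_const cardC1 card_ord -[_ *+ n.-1]mulr_natr.
have -> : n.-1%:R = n%:R - 1 :> R by rewrite -subn1 natrB//; case: n s0 => // -[].
by ring.
Qed.

Lemma n_ge1 : 1 <= n%:R :> R.
Proof. by rewrite ler1n; case: n s0 => // -[]. Qed.

(** Add X = Y + 2 C_w over w = 1, i, j, k. The C_w sum to Y by Parseval, so 4X = 6Y and Y = 2X/3. *)
Lemma fourth_moment_arm3 :
  (forall m l w, m != l -> qnorm2 w = 1 -> symmetry M (mix m l w) (mix m l (qopp w))) ->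
  X = 6 / (n%:R * (n%:R + 1 / 2)).
Proof.
move=> Mmix; have n1 := n_ge1.
have /mean_qn_total_scaled h : forall l, l != s0 -> E (fun x => qn s0 x * qn l x) = 2 / 3 * X.
  move=> l; rewrite eq_sym => sl.
  have h w w1 := mean_mix sl w1 (Mmix _ _ w sl w1).
  have h1 := h unit_1 ltac:(by rewrite /qnorm2 /=; ring).
  have hi := h unit_i qnorm2_unit_i.
  have hj := h unit_j qnorm2_unit_j.
  have hk := h unit_k ltac:(by rewrite /qnorm2 /=; ring).
  have : E (fun x => qn s0 x * qn l x) =
      E (fun x => qdot s0 l unit_1 x ^+ 2) + E (fun x => qdot s0 l unit_i x ^+ 2)
      + E (fun x => qdot s0 l unit_j x ^+ 2) + E (fun x => qdot s0 l unit_k x ^+ 2).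
    rewrite -!(meanD H)//; do ?apply: (goodD H) => //.
    by apply: (mean_eq H) => x _; rewrite sum_rdot_lq.
  by move: h1 hi hj hk; move: (E _) (E _) (E _) (E _) (E _) => *; lra.
have nR : n%:R * (n%:R + 1 / 2) != 0 :> R by nra.
apply: (mulIf nR); rewrite mulfVK//.
have -> : n%:R * (n%:R + 1 / 2) = (1 + (n%:R - 1) * (2 / 3)) * (n%:R * (3 / 2)) :> R by field.
by rewrite [LHS]mulrA h; field; rewrite n_neq0.
Qed.

(** Only w = 1 and w = j are available, and C_1 + C_j = Y; thus 2X = 4Y. *)
Lemma fourth_moment_arm2 : M `<=` planar ->
  (forall m l w, m != l -> qnorm2 w = 1 -> qi w = 0 -> qk w = 0 ->
     symmetry M (mix m l w) (mix m l (qopp w))) ->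
  X = 8 / (n%:R * (n%:R + 1)).
Proof.
move=> Mp Mmix; have n1 := n_ge1.
have /mean_qn_total_scaled h : forall l, l != s0 -> E (fun x => qn s0 x * qn l x) = 1 / 2 * X.
  move=> l; rewrite eq_sym => sl.
  have h w w1 wi wk := mean_mix sl w1 (Mmix _ _ w sl w1 wi wk).
  have h1 := h unit_1 ltac:(by rewrite /qnorm2 /=; ring) erefl erefl.
  have hj := h unit_j qnorm2_unit_j erefl erefl.
  have : E (fun x => qn s0 x * qn l x) =
      E (fun x => qdot s0 l unit_1 x ^+ 2) + E (fun x => qdot s0 l unit_j x ^+ 2).
    rewrite -!(meanD H)//; apply: (mean_eq H) => x /Mp/planarE px; rewrite sum_rdot_lq_planar//.
    by case: px => px; [left|right].
  by move: h1 hj; move: (E _) (E _) (E _) => *; lra.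
have nR : n%:R * (n%:R + 1) != 0 :> R by nra.
apply: (mulIf nR); rewrite mulfVK//.
have -> : n%:R * (n%:R + 1) = (1 + (n%:R - 1) * (1 / 2)) * (n%:R * 2) :> R by field.
by rewrite [LHS]mulrA h; field; rewrite n_neq0.
Qed.

(* The Gram matrix of the rows, h_ml = a_m conj(a_l) + b_m conj(b_l), is a projection. *)
Lemma sum_herm_sqr x m : model_pol3 n x ->
  \sum_l (qdot m l unit_1 x ^+ 2 + qdot m l unit_i x ^+ 2) = qn m x.
Proof.
move=> /model_pol3_forms[xA xB xr xi]; set r := row m x.
transitivity (formA r * \sum_l formA (row l x) + formB r * \sum_l formB (row l x)
    + (2 * formRe r * \sum_l formRe (row l x) + 2 * formIm r * \sum_l formIm (row l x))).
  rewrite !mulr_sumr -!big_split/=; apply: eq_bigr => l _.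
  by rewrite herm_sqr -/r; ring.
by rewrite xA xB xr xi /qn rdot_form -/r; ring.
Qed.

(** Here [f l] is the squared modulus of the (s0, l) entry of the Gram matrix of the rows. Writing Y
    and F for the off-diagonal sums of the two kinds of averages, X + Y = 4/n, X + F = 2/n and (n -
    1)X = Y + aF; eliminate Y and F. *)
Lemma fourth_moment_pol (a : R) (f : 'I_n -> V -> R) :
  (forall l, good (f l)) -> (forall x, M x -> \sum_l f l x = qn s0 x) ->
  (forall x, M x -> f s0 x = qn s0 x ^+ 2) ->
  (forall l, l != s0 -> X = E (fun x => qn s0 x * qn l x) + a * E (f l)) ->
  X * (n%:R + a) = (4 + 2 * a) / n%:R.
Proof.
move=> gf fsum fs0 h; have tot := mean_qn_total.
have : E (fun x => \sum_l f l x) = 2 / n%:R.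
  by rewrite -mean_qn; exact: (mean_eq H) fsum.
rewrite mean_sum// (bigD1 s0)//= (mean_eq H fs0) -/X.
have : X *+ n.-1 = \sum_(l | l != s0) E (fun x => qn s0 x * qn l x)
    + a * \sum_(l | l != s0) E (f l).
  rewrite mulr_sumr -big_split/= -(eq_bigr _ h) sumr_const cardC1 card_ord.
  by [].
rewrite -[_ *+ n.-1]mulr_natr.
have -> : n.-1%:R = n%:R - 1 :> R by rewrite -subn1 natrB//; case: n s0 => // -[].
move: tot; move: (\sum_(l | _) E (f l)) (\sum_(l | _) E _) => F Y tot eX eF.
have -> : X * (n%:R + a) = X * (n%:R - 1) + X + a * X by ring.
have -> : X * (n%:R - 1) + X + a * X = (X + Y) + a * (X + F) by rewrite eX; ring.
by rewrite tot eF; ring.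
Qed.

(** Averaging the relations for w = 1 and w = i replaces 2 C_w by C_1 + C_i, the mean of the squared
    modulus; hence a = 1. *)
Lemma fourth_moment_pol3 : M `<=` model_pol3 n ->
  (forall m l w, m != l -> qnorm2 w = 1 -> qj w = 0 -> qk w = 0 ->
     symmetry M (mix m l w) (mix m l (qopp w))) ->
  X = 6 / (n%:R * (n%:R + 1)).
Proof.
move=> Mp Mmix; have n1 := n_ge1.
have h : X * (n%:R + 1) = (4 + 2 * 1) / n%:R.
  apply: (@fourth_moment_pol 1 (fun l x => qdot s0 l unit_1 x ^+ 2 + qdot s0 l unit_i x ^+ 2)).
  - by move=> l; exact: (goodD H).
  - by move=> x /Mp; exact: sum_herm_sqr.
  - by move=> x _; rewrite /qdot rdot_lq_i rdot_lq_1 /qn; ring.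
  - move=> l; rewrite eq_sym => sl.
    have h w w1 wj wk := mean_mix sl w1 (Mmix _ _ w sl w1 wj wk).
    have h1 := h unit_1 ltac:(by rewrite /qnorm2 /=; ring) erefl erefl.
    have hi := h unit_i qnorm2_unit_i erefl erefl.
    rewrite (meanD H)//; move: h1 hi; move: (E _) (E _) (E _) => *; lra.
have nR : n%:R * (n%:R + 1) != 0 :> R by nra.
apply: (mulIf nR); rewrite mulfVK// mulrCA h mulrCA mulfV ?n_neq0//; ring.
Qed.

(** The Gram matrix of the rows is real, so C_1 alone is the mean of the squared modulus; hence a =
    2. *)
Lemma fourth_moment_pol2 : M `<=` model_pol3 n `&` planar ->
  (forall m l, m != l -> symmetry M (mix m l unit_1) (mix m l (qopp unit_1))) ->
  X = 8 / (n%:R * (n%:R + 2)).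
Proof.
move=> Mp Mmix; have n1 := n_ge1.
have u1 : qnorm2 unit_1 = 1 :> R by rewrite /qnorm2 /=; ring.
have h : X * (n%:R + 2) = (4 + 2 * 2) / n%:R.
  apply: (@fourth_moment_pol 2 (fun l x => qdot s0 l unit_1 x ^+ 2)).
  - by move=> l.
  - move=> x /Mp[x3 /planarE px]; rewrite -sum_herm_sqr//; apply: eq_bigr => l _.
    rewrite [X in _ + X ^+ 2]rdot_lq_i_planar ?expr0n ?addr0//.
    by case: px => px; [left|right].
  - by move=> x _; rewrite /qdot rdot_lq_1.
  - move=> l; rewrite eq_sym => sl.
    by rewrite -(mean_mix sl u1 (Mmix _ _ sl)).
have nR : n%:R * (n%:R + 2) != 0 :> R by nra.
apply: (mulIf nR); rewrite mulfVK// mulrCA h mulrCA mulfV ?n_neq0//; ring.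
Qed.

Lemma sum_lt_const (k : nat) (a : R) : (k <= n)%N -> \sum_(m < n | (m < k)%N) a = k%:R * a.
Proof.
move=> kn; rewrite -(big_ord_widen n (fun=> a) kn) sumr_const card_ord.
by rewrite -[LHS]mulr_natl.
Qed.

Lemma mean_double_sum (W : 'I_n -> 'I_n -> V -> R) (k : nat) (A Z : R) : (k <= n)%N ->
  (forall m l, good (W m l)) -> (forall m, E (W m m) = A) ->
  (forall m l, m != l -> E (W m l) = Z) ->
  E (fun x => \sum_(m < n | (m < k)%N) \sum_(l < n | (l < k)%N) W m l x) =
  k%:R * (A + (k%:R - 1) * Z).
Proof.
move=> kn gW EA EZ.
rewrite mean_sum; last by move=> m; exact: good_sum.
rewrite -[RHS](sum_lt_const _ kn); apply: eq_bigr => m mk.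
rewrite mean_sum// (bigD1 m)//= EA; congr (_ + _).
rewrite (eq_bigr (fun=> Z)) => [|l /andP[_ lm]]; last by rewrite EZ// eq_sym.
(* Adding the missing diagonal term Z completes the row to k equal terms. *)
apply: (addrI Z); transitivity (\sum_(l < n | (l < k)%N) Z); first by rewrite [RHS](bigD1 m).
by rewrite sum_lt_const//; ring.
Qed.

End Moments.

(** * Chord lengths *)

Section HopfRows.
Context {R : realType} {n : nat}.
Local Notation V := 'M[R]_(n, 4).
Implicit Types (x : V) (m l : 'I_n) (r t : 'rV[R]_4).

Lemma ord3P (Q : 'I_3 -> Prop) : Q 0 -> Q 1 -> Q 2 -> forall c, Q c.
Proof.
move=> Q0 Q1 Q2 [[|[|[|c]]] lt_c3] //.
- by have -> : Ordinal lt_c3 = 0 by exact: val_inj.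
- by have -> : Ordinal lt_c3 = 1 by exact: val_inj.
- by have -> : Ordinal lt_c3 = 2 by exact: val_inj.
Qed.

Lemma ord2P (Q : 'I_2 -> Prop) : Q 0 -> Q 1 -> forall c, Q c.
Proof.
move=> Q0 Q1 [[|[|c]] lt_c2] //.
- by have -> : Ordinal lt_c2 = 0 by exact: val_inj.
- by have -> : Ordinal lt_c2 = 1 by exact: val_inj.
Qed.

Lemma sum_ord3 (F : 'I_3 -> R) : \sum_(c < 3) F c = F 0 + F 1 + F 2.
Proof.
rewrite !big_ord_recr big_ord0 /= add0r.
by congr (F _ + F _ + F _); exact: val_inj.
Qed.

Lemma sum_ord2 (F : 'I_2 -> R) : \sum_(c < 2) F c = F 0 + F 1.
Proof.
rewrite !big_ord_recr big_ord0 /= add0r.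
by congr (F _ + F _); exact: val_inj.
Qed.

Lemma hopf3E x m : ((hopf3 x m 0 = formA (row m x) - formB (row m x)) *
  (hopf3 x m 1 = - 2 * formIm (row m x))) * (hopf3 x m 2 = 2 * formRe (row m x)).
Proof.
by do !split; rewrite /formA /formB /formRe /formIm; do 4 rewrite ?mxE /=; ring.
Qed.

Lemma hopf2E x m : (hopf2 x m 0 = formA (row m x) - formB (row m x)) *
  (hopf2 x m 1 = 2 * formRe (row m x)).
Proof.
by do !split; rewrite /formA /formB /formRe /formIm; do 4 rewrite ?mxE /=; ring.
Qed.

Definition hopf_dot m l x : R := \sum_(c < 3) hopf3 x m c * hopf3 x l c.

Lemma hopf_dotE m l x : hopf_dot m l x =
  (formA (row m x) - formB (row m x)) * (formA (row l x) - formB (row l x)) +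
  4 * (formRe (row m x) * formRe (row l x) + formIm (row m x) * formIm (row l x)).
Proof. by rewrite /hopf_dot sum_ord3 !hopf3E; ring. Qed.

(** The identity (|a|^2 - |b|^2)^2 + 4 |a|^2 |b|^2 = (|a|^2 + |b|^2)^2, that is |e_m| = |q_m|^2. *)
Lemma hopf_dot_diag m x : hopf_dot m m x = qn m x ^+ 2.
Proof. by rewrite hopf_dotE /qn rdot_form /formA /formB /formRe /formIm; ring. Qed.

(** As j(a + b j) = -conj(b) + conj(a) j, the squared norms of a and b are exchanged and b conj(a)
    changes sign. *)
Lemma hopf_dot_lq_j m l x : m != l ->
  hopf_dot m l (lq_row m l unit_j x) = - hopf_dot m l x.
Proof.
move=> ml; have lm : (l == m) = false by rewrite eq_sym (negPf ml).
rewrite !hopf_dotE /lq_row !row_on_rows !eqxx lm /formA /formB /formRe /formIm.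
by do 3 rewrite ?mxE /=; ring.
Qed.

Lemma chordE d k (e : 'M[R]_(n, d)) :
  chord k e = \sum_(c < d) (\sum_(m < n | (m < k)%N) e m c) ^+ 2.
Proof.
rewrite /chord /eucl_norm sqr_sqrtr; last by apply: sumr_ge0 => c _; exact: sqr_ge0.
apply: eq_bigr => c _; congr (_ ^+ 2); rewrite summxE.
by apply: eq_bigr => m _; rewrite mxE.
Qed.

Lemma chord_hopf3 k x : chord k (hopf3 x) =
  \sum_(m < n | (m < k)%N) \sum_(l < n | (l < k)%N) hopf_dot m l x.
Proof.
rewrite chordE /hopf_dot; under [RHS]eq_bigr do rewrite exchange_big/=.
rewrite [RHS]exchange_big/=; apply: eq_bigr => c _.
by rewrite expr2 mulr_suml; apply: eq_bigr => m _; rewrite mulr_sumr.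
Qed.

Lemma planar_formIm x m : planar x -> formIm (row m x) = 0.
Proof. by rewrite /formIm !mxE => -[/(_ m)[-> ->]|/(_ m)[-> ->]]; ring. Qed.

(** The j-coordinate of every edge is a multiple of [formIm], which vanishes on [planar]; the planar
    cases thus reuse the spatial expansion of the chord. *)
Lemma chord_hopf2 k x : planar x -> chord k (hopf2 x) = chord k (hopf3 x).
Proof.
move=> xp; rewrite !chordE sum_ord2 sum_ord3.
rewrite [X in _ = _ + X ^+ 2 + _]big1 ?expr0n ?addr0 => [|m _]; last first.
  by rewrite hopf3E planar_formIm// mulr0.
by congr (_ ^+ 2 + _ ^+ 2); apply: eq_bigr => m _; rewrite hopf2E hopf3E.
Qed.

Lemma qn_ge0 m x : 0 <= qn m x.
Proof. by rewrite /qn rdot_form !addr_ge0 ?sqr_ge0. Qed.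

Lemma sphere_sum_qn x : sphere n x <-> \sum_m qn m x = 2.
Proof. by rewrite model_arm3_mxdot mxdotE. Qed.

Lemma arm_hopf3 x : sphere n x -> arm 3 n (hopf3 x).
Proof.
move=> /sphere_sum_qn xN; rewrite /arm/= -[RHS]xN; apply: eq_bigr => m _.
rewrite /eucl_norm -[RHS]ger0_norm ?qn_ge0// -sqrtr_sqr -hopf_dot_diag; congr Num.sqrt.
by apply: eq_bigr => c _; rewrite mxE expr2.
Qed.

Lemma arm_hopf2 x : sphere n x -> planar x -> arm 2 n (hopf2 x).
Proof.
move=> /arm_hopf3; rewrite /arm/= => h xp; apply: etrans h; apply: eq_bigr => m _.
rewrite /eucl_norm; congr Num.sqrt; rewrite sum_ord2 sum_ord3.
have rE d (e : 'M[R]_(n, d)) c : row m e 0 c = e m c by rewrite mxE.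
by rewrite !rE !hopf2E !hopf3E planar_formIm// mulr0 expr0n addr0.
Qed.

Lemma model_pol3_sphere x : model_pol3 n x -> sphere n x.
Proof. by rewrite model_pol3E sphereE /= => -[-> -> _ _]. Qed.

Lemma sum_hopf3 x c : model_pol3 n x -> \sum_m hopf3 x m c = 0.
Proof.
move=> /model_pol3_forms[xA xB xr xi]; elim/ord3P: c; under eq_bigr do rewrite hopf3E.
- by rewrite big_split/= sumrN xA xB subrr.
- by rewrite -mulr_sumr xi mulr0.
- by rewrite -mulr_sumr xr mulr0.
Qed.

Lemma sum_hopf2 x c : model_pol3 n x -> \sum_m hopf2 x m c = 0.
Proof.
move=> /model_pol3_forms[xA xB xr xi]; elim/ord2P: c; under eq_bigr do rewrite hopf2E.
- by rewrite big_split/= sumrN xA xB subrr.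
- by rewrite -mulr_sumr xr mulr0.
Qed.

Lemma pol_of_arm d (e : 'M[R]_(n, d)) : arm d n e -> (forall c, \sum_m e m c = 0) -> pol d n e.
Proof.
move=> ae e0; split=> //=; apply/rowP => c; rewrite summxE mxE -[RHS](e0 c).
by apply: eq_bigr => m _; rewrite mxE.
Qed.

Lemma sphere_entry_bound x s c : sphere n x -> `|x s c| <= 2.
Proof.
move=> /model_arm3_mxdot xN.
have : x s c ^+ 2 <= 2.
  rewrite -[leRHS]xN /mxdot (bigD1 s)//= (bigD1 c)//= -addrA lerDl addr_ge0//.
    by apply: sumr_ge0 => t _; rewrite -expr2 sqr_ge0.
  by apply: sumr_ge0 => t _; apply: sumr_ge0 => b _; rewrite -expr2 sqr_ge0.
rewrite -real_normK ?num_real// => h.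
rewrite -(ler_pXn2r (ltn0Sn 1)) ?nnegrE//; apply: le_trans h _.
by rewrite -natrX ler_nat.
Qed.

End HopfRows.

(** * Continuity of the Hopf maps and measurability *)

Section Regularity.
Context {R : realType} {n : nat}.
Local Notation V := 'M[R]_(n, 4).

Lemma mx_continuous d (h : V -> 'M[R]_(n, d)) :
  (forall s c x, differentiable (fun y => h y s c) x) -> continuous h.
Proof.
by move=> dh x; apply: differentiable_continuous; apply: differentiable_mx => s c.
Qed.

Lemma hopf3_continuous : continuous (@hopf3 R n).
Proof.
apply: mx_continuous => s c x; elim/ord3P: c; under eq_fun do rewrite hopf3E /formA /formB /formRe /formIm !mxE;
by diff_tac.
Qed.

Lemma hopf2_continuous : continuous (@hopf2 R n).
Proof.
apply: mx_continuous => s c x; elim/ord2P: c; under eq_fun do rewrite hopf2E /formA /formB /formRe /formIm !mxE;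
by diff_tac.
Qed.

Lemma measurable_entry d (s : 'I_n) (c : 'I_d) :
  measurable_fun setT ((fun e => e s c) : borel 'M[R]_(n, d) -> R).
Proof. by apply: continuous_borel_measurable_real; exact: coord_continuous. Qed.

Lemma measurable_level d (f : borel 'M[R]_(n, d) -> R) (a : R) :
  measurable_fun setT f -> measurable [set e | f e = a].
Proof.
by move=> mf; have := mf measurableT [set a] (measurable_set1 a); rewrite setTI.
Qed.

Lemma measurable_sumr {dT} {T : measurableType dT} (I : Type) (r : seq I) (Q : pred I)
    (f : I -> T -> R) : (forall i, measurable_fun setT (f i)) ->
  measurable_fun setT (fun x => \sum_(i <- r | Q i) f i x).
Proof.
move=> mf; under eq_fun do rewrite -big_filter; exact: measurable_sum.
Qed.

Lemma measurable_arm d : measurable (arm d n : set (borel 'M[R]_(n, d))).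
Proof.
apply: (@measurable_level d (fun e => \sum_(m < n) eucl_norm (row m e))).
apply: measurable_sumr => m; rewrite /eucl_norm.
apply: (@measurableT_comp _ _ _ _ _ _ (@Num.sqrt R)).
  by apply: continuous_measurable_fun; exact: sqrt_continuous.
apply: measurable_sumr => c; apply: measurable_funX.
by under eq_fun do rewrite mxE; exact: measurable_entry.
Qed.

Lemma measurable_chord d k : measurable_fun setT (chord k : borel 'M[R]_(n, d) -> R).
Proof.
have -> : chord k = (fun e : 'M[R]_(n, d) => \sum_(c < d) (\sum_(m < n | (m < k)%N) e m c) ^+ 2).
  by apply/funext => e; exact: chordE.
apply: measurable_sumr => c; apply: measurable_funX; apply: measurable_sumr => m.
exact: measurable_entry.
Qed.

Lemma measurable_pol d : measurable (pol d n : set (borel 'M[R]_(n, d))).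
Proof.
apply: measurableI; first exact: measurable_arm.
(* The vector condition becomes a level set of one real measurable function. *)
have -> : [set e : 'M[R]_(n, d) | \sum_(m < n) row m e = 0] = [set e | chord n e = 0].
  have e0 (v : 'rV[R]_d) : v = 0 <-> eucl_norm v ^+ 2 = 0.
    rewrite /eucl_norm; split=> [->|/eqP].
      by rewrite big1 ?sqrtr0 ?expr0n// => c _; rewrite mxE expr0n.
    rewrite sqr_sqrtr; last by apply: sumr_ge0 => c _; exact: sqr_ge0.
    rewrite psumr_eq0 => [/allP v0|c _]; last exact: sqr_ge0.
    apply/rowP => c; rewrite mxE; apply/eqP.
    by have := v0 c (mem_index_enum _); rewrite sqrf_eq0.
  have sE (e : 'M[R]_(n, d)) : \sum_(m < n) row m e = \sum_(m < n | (m < n)%N) row m e.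
    by apply: eq_bigl => m; rewrite ltn_ord.
  by apply/seteqP; split=> e /=; rewrite sE /chord => /e0.
exact: measurable_level (measurable_chord _).
Qed.

Lemma measurable_sqn_sum (c b : 'I_4) :
  measurable_fun setT ((fun x => \sum_s (x s c ^+ 2 + x s b ^+ 2)) : borel V -> R).
Proof.
apply: measurable_sumr => s; apply: measurable_funD; apply: measurable_funX; exact: measurable_entry.
Qed.

Lemma measurable_sphere : measurable (sphere n : set (borel V)).
Proof.
rewrite sphereE; apply: measurable_level.
by apply: measurable_funD; exact: measurable_sqn_sum.
Qed.

Lemma measurable_planar : measurable (planar : set (borel V)).
Proof.
have h (c b : 'I_4) : measurable ([set x : V | forall s, x s c = 0 /\ x s b = 0] : set (borel V)).
  have -> : [set x : V | forall s, x s c = 0 /\ x s b = 0] =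
      [set x | \sum_s (x s c ^+ 2 + x s b ^+ 2) = 0].
    apply/seteqP; split=> x /= h.
      by apply: big1 => s _; have [-> ->] := h s; rewrite expr0n addr0.
    move=> s; move/eqP: h; rewrite psumr_eq0 => [/allP/(_ s (mem_index_enum _))|t _].
      by rewrite paddr_eq0 ?sqr_ge0//= !sqrf_eq0 => /andP[/eqP-> /eqP->].
    by rewrite addr_ge0 ?sqr_ge0.
  exact: measurable_level (measurable_sqn_sum c b).
by apply: measurableU; exact: h.
Qed.

Lemma measurable_model_pol3 : measurable (model_pol3 n : set (borel V)).
Proof.
have -> : model_pol3 n = [set x : V | sqnA x = 1] `&` [set x | sqnB x = 1] `&`
    [set x | hermRe x = 0] `&` [set x | hermIm x = 0].
  by rewrite model_pol3E; apply/seteqP; split=> x /= [] => [|[[]]].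
have mM (c b : 'I_4) (s : 'I_n) : measurable_fun setT ((fun x => x s c * x s b) : borel V -> R).
  by apply: measurable_funM; exact: measurable_entry.
apply: measurableI; [apply: measurableI; [apply: measurableI|]|].
- exact: (measurable_level 1 (measurable_sqn_sum _ _)).
- exact: (measurable_level 1 (measurable_sqn_sum _ _)).
- by apply: (@measurable_level 4 (@hermRe R n)); apply: measurable_sumr => s; exact: measurable_funD.
- by apply: (@measurable_level 4 (@hermIm R n)); apply: measurable_sumr => s; exact: measurable_funB.
Qed.

End Regularity.

(** * Mean chord lengths in terms of the fourth moment *)

Section ChordMeans.
Context {R : realType} {n : nat}.
Local Notation V := 'M[R]_(n, 4).
Variables (M : set V) (good : (V -> R) -> Prop) (E : (V -> R) -> R).
Hypothesis H : mean M good E.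
Variable k : nat.
Hypothesis kn : (k <= n)%N.

Lemma good_hopf3 m c : good (fun x => hopf3 x m c).
Proof.
have gE s b : good (fun x : V => x s b) := good_entry H s b.
have g2 (f g : V -> R) : good f -> good g -> good (fun x => f x ^+ 2 + g x ^+ 2).
  by move=> gf gg; exact: (goodD H (goodX2 H gf) (goodX2 H gg)).
have gB (f g : V -> R) : good f -> good g -> good (fun x => f x - g x).
  by move=> gf gg; exact: (goodD H gf (goodN H gg)).
elim/ord3P: c; under eq_fun do rewrite hopf3E /formA /formB /formRe /formIm !mxE.
- by apply: gB; exact: g2.
- by apply: (goodM H); [exact: (good_cst H)|apply: gB; exact: (goodM H (gE _ _) (gE _ _))].
- by apply: (goodM H); [exact: (good_cst H)|apply: (goodD H); exact: (goodM H (gE _ _) (gE _ _))].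
Qed.

Lemma good_hopf_dot m l : good (hopf_dot m l).
Proof. by apply: (good_sum H) => c; apply: (goodM H); exact: good_hopf3. Qed.

Lemma good_chord_hopf3 : good (chord k \o hopf3).
Proof.
have -> : chord k \o hopf3 = (fun x : V =>
    \sum_(m < n | (m < k)%N) \sum_(l < n | (l < k)%N) hopf_dot m l x).
  by apply/funext => x; exact: chord_hopf3.
by apply: (good_sum H) => m; apply: (good_sum H) => l; exact: good_hopf_dot.
Qed.

Lemma mean_chord_hopf3 (A Z : R) :
  (forall m, E (fun x => qn m x ^+ 2) = A) ->
  (forall m l, m != l -> E (hopf_dot m l) = Z) ->
  E (chord k \o hopf3) = k%:R * (A + (k%:R - 1) * Z).
Proof.
move=> EA EZ.
have -> : chord k \o hopf3 = (fun x : V =>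
    \sum_(m < n | (m < k)%N) \sum_(l < n | (l < k)%N) hopf_dot m l x).
  by apply/funext => x; exact: chord_hopf3.
apply: (mean_double_sum H kn good_hopf_dot) => // m.
by rewrite -(EA m); congr E; apply/funext => x; exact: hopf_dot_diag.
Qed.

Lemma mean_hopf_dot_arm m l : m != l ->
  symmetry M (lq_row m l unit_j) (lq_row m l (qconj unit_j)) -> E (hopf_dot m l) = 0.
Proof.
move=> ml sT; have := mean_sym H sT (good_hopf_dot m l).
have -> : hopf_dot m l \o lq_row m l unit_j = (fun x : V => - hopf_dot m l x).
  by apply/funext => x; exact: hopf_dot_lq_j.
rewrite (meanN H); last exact: good_hopf_dot.
by move: (E _) => e h; lra.
Qed.

Lemma mean_hopf_dot_pol (A : R) m l : M `<=` model_pol3 n -> (2 <= n)%N ->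
  (forall m l, m != l -> symmetry M (swap m l) (swap m l)) ->
  (forall m, E (fun x => qn m x ^+ 2) = A) -> m != l ->
  E (hopf_dot m l) = - A / (n%:R - 1).
Proof.
move=> Mp n2 Mswap EA ml.
have n1 : n%:R - 1 != 0 :> R by rewrite subr_eq0 (eqr_nat R n 1) gtn_eqF.
(* Exchanging rows l' and l leaves row m in place, both being different from m. *)
have Zeq l' : l' != m -> E (hopf_dot m l') = E (hopf_dot m l).
  move=> lm'; have [->//|ll] := eqVneq l' l.
  rewrite -(mean_sym H (Mswap _ _ ll) (good_hopf_dot m l')); congr E.
  apply/funext => x; rewrite /= !hopf_dotE !row_on_rows eqxx.
  by rewrite (eq_sym m l') (negPf lm') (negPf ml).
have : E (fun x => \sum_l' hopf_dot m l' x) = 0.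
  apply: (etrans _ (mean_cst H 0)); apply: (mean_eq H) => x /Mp xM.
  rewrite /hopf_dot exchange_big big1//= => c _.
  by rewrite -mulr_sumr sum_hopf3// mulr0.
rewrite (mean_sum H); last by move=> l'; exact: good_hopf_dot.
rewrite (bigD1 m)//= (eq_bigr (fun=> E (hopf_dot m l)) Zeq) sumr_const cardC1 card_ord.
rewrite -[_ *+ n.-1]mulr_natr -subn1 natrB; last by rewrite ltnW.
have -> : E (hopf_dot m m) = A.
  by rewrite -(EA m); congr E; apply/funext => x; exact: hopf_dot_diag.
move=> /eqP; rewrite addrC addr_eq0 => /eqP h.
by rewrite -h mulfK.
Qed.

Lemma mean_chord_hopf2 : M `<=` planar -> E (chord k \o hopf2) = E (chord k \o hopf3).
Proof. by move=> Mp; apply: (mean_eq H) => x /Mp; exact: chord_hopf2. Qed.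

Lemma good_chord_hopf2 : good (chord k \o hopf2).
Proof.
have -> : chord k \o hopf2 = (fun x : V =>
    \sum_(c < 2) (\sum_(m < n | (m < k)%N) hopf2 x m c) ^+ 2).
  by apply/funext => x; exact: chordE.
apply: (good_sum H) => c; apply: (goodX2 H); apply: (good_sum H) => m.
elim/ord2P: c; under eq_fun do rewrite hopf2E.
- by under eq_fun do rewrite -hopf3E; exact: good_hopf3.
- by under eq_fun do rewrite -hopf3E; exact: good_hopf3.
Qed.

End ChordMeans.

Lemma chord_ge0 {R : realType} {d n k : nat} (e : 'M[R]_(n, d)) : 0 <= chord k e.
Proof. exact: sqr_ge0. Qed.

Unset Implicit Arguments.

Theorem proposition18 (R : realType) (n k : nat) (n_ge2 : (2 <= n)%N)
    (k_bounds : (1 <= k <= n)%N) :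
  [/\ forall P : probability (borel 'M[R]_(n, 3)) R, symmetric_arm3 n P ->
        (\int[P]_(e in arm 3 n) (chord k e)%:E
         = (6 * k%:R / (n%:R * (n%:R + 1 / 2)))%:E)%E,
      forall P : probability (borel 'M[R]_(n, 3)) R, symmetric_pol3 n P ->
        (\int[P]_(e in pol 3 n) (chord k e)%:E
         = ((n%:R - k%:R) / (n%:R - 1) * (6 * k%:R / (n%:R * (n%:R + 1))))%:E)%E,
      forall P : probability (borel 'M[R]_(n, 2)) R, symmetric_arm2 n P ->
        (\int[P]_(e in arm 2 n) (chord k e)%:E
         = (8 * k%:R / (n%:R * (n%:R + 1)))%:E)%E &
      forall P : probability (borel 'M[R]_(n, 2)) R, symmetric_pol2 n P ->
        (\int[P]_(e in pol 2 n) (chord k e)%:E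
         = ((n%:R - k%:R) / (n%:R - 1) * (8 * k%:R / (n%:R * (n%:R + 2))))%:E)%E].
Proof.
have kn : (k <= n)%N by case/andP: k_bounds.
have n1 : n%:R - 1 != 0 :> R by rewrite subr_eq0 (eqr_nat R n 1) gtn_eqF.
(* Closing the polygon replaces A by A - (k - 1) A/(n - 1) = A (n - k)/(n - 1). *)
have pol_value (A : R) : k%:R * (A + (k%:R - 1) * (- A / (n%:R - 1))) =
    (n%:R - k%:R) / (n%:R - 1) * (k%:R * A) by field.
have pol3_sphere x : model_pol3 n x -> \sum_(m < n) qn m x = 2 :> R.
  by move=> /model_pol3_sphere/sphere_sum_qn.
split=> P.
- move=> hP.
  have [good [E [H ->//]]] := mean_normalized_pushforward hP measurable_sphere
    finite_atlas_arm3 (fun x xM s c => sphere_entry_bound s c xM) hopf3_continuous.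
  + congr (_%:E); rewrite (mean_chord_hopf3 H kn (A := 6 / (n%:R * (n%:R + 1 / 2))) (Z := 0)).
    * by rewrite mulr0 addr0; ring.
    * move=> m; apply: (fourth_moment_arm3 H sphere_swap).
        by move=> x; exact: (sphere_sum_qn x).1.
      by move=> p l w pl; exact: sphere_mix.
    * by move=> m l ml; apply: (mean_hopf_dot_arm H ml); exact: (sphere_lq_row ml qnorm2_unit_j).
  + exact: measurable_arm.
  + exact: measurable_chord.
  + exact: chord_ge0.
  + exact: arm_hopf3.
  + exact: good_chord_hopf3 H _.
- move=> hP.
  have [good [E [H ->//]]] := mean_normalized_pushforward hP measurable_model_pol3
    finite_atlas_pol3 (fun x xM s c => sphere_entry_bound s c (model_pol3_sphere xM))
    hopf3_continuous.
  + have EA m : E (fun x => qn m x ^+ 2) = 6 / (n%:R * (n%:R + 1)).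
      apply: (fourth_moment_pol3 H model_pol3_swap pol3_sphere) => // p l w pl.
      exact: model_pol3_mix.
    congr (_%:E); rewrite (mean_chord_hopf3 H kn EA (Z := - (6 / (n%:R * (n%:R + 1))) / (n%:R - 1))).
      by rewrite pol_value; ring.
    by move=> m l ml; apply: (mean_hopf_dot_pol H _ n_ge2 model_pol3_swap EA ml).
  + exact: measurable_pol.
  + exact: measurable_chord.
  + exact: chord_ge0.
  + move=> x xM; apply: pol_of_arm => [|c]; last exact: sum_hopf3.
    exact: arm_hopf3 (model_pol3_sphere xM).
  + exact: good_chord_hopf3 H _.
- rewrite /symmetric_arm2 => hP; have atl := @finite_atlas_arm2 R n.
  (* In this form a symmetry of the model is a common symmetry of the sphere and of [planar]. *)
  rewrite model_arm2E in hP atl.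
  have mM := measurableI _ _ (@measurable_sphere R n) measurable_planar.
  have Mp : (sphere n `&` planar : set 'M[R]_(n, 4)) `<=` planar by move=> x [].
  have [good [E [H ->//]]] := mean_normalized_pushforward hP mM
    atl (fun x xM s c => sphere_entry_bound s c xM.1) hopf2_continuous.
  + congr (_%:E); rewrite (mean_chord_hopf2 H _ Mp).
    rewrite (mean_chord_hopf3 H kn (A := 8 / (n%:R * (n%:R + 1))) (Z := 0)).
    * by rewrite mulr0 addr0; ring.
    * move=> m; apply: (fourth_moment_arm2 H).
      - by move=> p l pl; exact: symmetry_setI (sphere_swap pl) (planar_swap pl).
      - by move=> x [xM _]; exact: (sphere_sum_qn x).1.
      - exact: Mp.
      - by move=> p l w pl w1 wi wk; exact: symmetry_setI (sphere_mix pl w1) (planar_mix pl w1 wi wk).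
    * move=> m l ml; apply: (mean_hopf_dot_arm H ml).
      apply: symmetry_setI; first exact: (sphere_lq_row ml qnorm2_unit_j).
      by apply: planar_lq_row => //; exact: qnorm2_unit_j.
  + exact: measurable_arm.
  + exact: measurable_chord.
  + exact: chord_ge0.
  + by move=> x [xM xp]; exact: arm_hopf2.
  + exact: good_chord_hopf2 H _.
- rewrite /symmetric_pol2 => hP; have atl := @finite_atlas_pol2 R n.
  rewrite model_pol2E in hP atl.
  have mM := measurableI _ _ (@measurable_model_pol3 R n) measurable_planar.
  have Mp : (model_pol3 n `&` planar : set 'M[R]_(n, 4)) `<=` planar by move=> x [].
  have M3 : (model_pol3 n `&` planar : set 'M[R]_(n, 4)) `<=` model_pol3 n by move=> x [].
  have Mswap (m l : 'I_n) (ml : m != l) :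
      symmetry (model_pol3 n `&` planar : set 'M[R]_(n, 4)) (swap m l) (swap m l).
    exact: symmetry_setI (model_pol3_swap ml) (planar_swap ml).
  have [good [E [H ->//]]] := mean_normalized_pushforward hP mM
    atl (fun x xM s c => sphere_entry_bound s c (model_pol3_sphere xM.1)) hopf2_continuous.
  + have EA m : E (fun x => qn m x ^+ 2) = 8 / (n%:R * (n%:R + 2)).
      apply: (fourth_moment_pol2 H Mswap) => // [x [xM _]|p l pl]; first exact: pol3_sphere.
      have u1 : qnorm2 unit_1 = 1 :> R by rewrite /qnorm2 /=; ring.
      exact: symmetry_setI (model_pol3_mix pl u1 erefl erefl) (planar_mix pl u1 erefl erefl).
    congr (_%:E); rewrite (mean_chord_hopf2 H _ Mp).
    rewrite (mean_chord_hopf3 H kn EA (Z := - (8 / (n%:R * (n%:R + 2))) / (n%:R - 1))).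
      by rewrite pol_value; ring.
    by move=> m l ml; apply: (mean_hopf_dot_pol H M3 n_ge2 Mswap EA ml).
  + exact: measurable_pol.
  + exact: measurable_chord.
  + exact: chord_ge0.
  + move=> x [xM xp]; apply: pol_of_arm => [|c]; last exact: sum_hopf2.
    exact: arm_hopf2 (model_pol3_sphere xM) xp.
  + exact: good_chord_hopf2 H _.
Qed.
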